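(* Let $X=(X_n)_{n\in\mathbb Z}$ be a stationary process with values in a finite set $A$, and let $(\delta_n)_{n\ge0}$ be defined from a fixed regular version of the conditional law of $X_0$ given $X^{\lhd}_{-1}$ as in the context. (1) If $2\delta_0<1$ and $$\sum_{k=0}^{+\infty}\prod_{n=0}^{k}(1-2\delta_n)=+\infty,$$ then the natural filtration $\mathcal F^X$ is standard. (2) If $A$ has exactly two elements and $$\sum_{k=0}^{+\infty}\prod_{n=0}^{k}(1-\delta_n)=+\infty,$$ then $\mathcal F^X$ is standard.
   Context: All $\sigma$-fields are complete. For a process $\xi$, $\xi^{\lhd}_n=(\xi_k)_{k\le n}$, $\mathcal F^\xi_n=\sigma(\xi^{\lhd}_n)$, and $\mathcal F^\xi=(\mathcal F^\xi_n)_{n\in\mathbb Z}$. For $i\le j$, $\xi_{i:j}=(\xi_n)_{i\le n\le j}$. $A^{\lhd}$ is the set of sequences $(x_n)_{n\le -1}$ with values in $A$; a sequence $(\xi_n)_{n\le i}$ is identified with the element of $A^\lhd$ obtained by shifting indices so that the last term has index $-1$. For $x\in A^\lhd$ and $z=(z_1,\dots,z_n)\in A^n$, $xz=(\dots,x_{-2},x_{-1},z_1,\dots,z_n)\in A^\lhd$. Let $p(\cdot|x)$, $x\in A^\lhd$, be a (fixed) regular version of the conditional law of $X_0$ given $X^{\lhd}_{-1}=x$. For probabilities $\mu,\nu$ on $A$, $\|\mu-\nu\|=\frac12\sum_{a}|\mu(a)-\nu(a)|$. For $n\ge0$, $$\delta_n=\sup\{\|p(\cdot|xz)-p(\cdot|yz)\|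 : x,y\in A^\lhd,\ z\in A^n\}.$$ A filtration $\mathcal F^X$ is standard if, possibly after enlarging the probability space, it is immersed in the natural filtration of some i.i.d. process, where $\mathcal F^X$ is immersed in $\mathcal G$ means $\mathcal F^X_n\subset\mathcal G_n$ for all $n$ and, for every $n$, $\mathcal F^X_{n+1}$ and $\mathcal G_n$ are independent conditionally on $\mathcal F^X_n$. *)

(* Defs.v *)
From HB Require Import structures.
From mathcomp Require Import all_boot all_order all_algebra.
From mathcomp Require Import all_classical all_reals all_analysis.
Set Implicit Arguments. Unset Strict Implicit. Unset Printing Implicit Defensive.
Import Order.TTheory GRing.Theory Num.Theory.
Import numFieldNormedType.Exports.
Local Open Scope classical_set_scope.
Local Open Scope ring_scope.

(* ---------- Sequences in A^< (indexed by nat: x k stands for x_{-(k+1)}) ---------- *)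

(* x z = (..., x_{-2}, x_{-1}, z_1, ..., z_n), reindexed so that the last term
   z_n has index -1, i.e. position 0. *)
Definition past_cat (A : Type) (n : nat) (x : nat -> A) (z : n.-tuple A) : nat -> A :=
  fun k => if (k < n)%N then nth (x 0%N) z (n.-1 - k)%N else x (k - n)%N.

Definition past_of (A T : Type) (xi : int -> T -> A) (i : int) (w : T) : nat -> A :=
  fun k => xi (i - k%:Z) w.

Definition tv (R : realType) (A : finType) (mu nu : A -> R) : R :=
  2^-1 * \sum_(a : A) `|mu a - nu a|.

Definition delta (R : realType) (A : finType) (p : (nat -> A) -> A -> R) (n : nat) : R :=
  sup [set r | exists (x y : nat -> A) (z : n.-tuple A),
                 r = tv (p (past_cat x z)) (p (past_cat y z))].

Definition cyl_sigma (A : Type) : set (set (nat -> A)) :=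
  <<s [set C | exists (k : nat) (a : A), C = [set x | x k = a]] >>.
Arguments cyl_sigma A : clear implicits.

Section Prob.
Context (d : measure_display) (Omega : measurableType d) (R : realType).

Definition stationary (P : probability Omega R) (A : finType) (X : int -> Omega -> A) :=
  forall (i : int) (n : nat) (z : n.-tuple A),
    P [set w | forall k : 'I_n, X (i + (k : nat)%:Z) w = tnth z k] =
    P [set w | forall k : 'I_n, X (i + 1 + (k : nat)%:Z) w = tnth z k].

Definition regular_cond_law (P : probability Omega R) (A : finType)
    (X : int -> Omega -> A) (p : (nat -> A) -> A -> R) :=
  (forall x a, 0 <= p x a) /\ (forall x, \sum_(a : A) p x a = 1) /\
  (forall a (S : set R), measurable S -> cyl_sigma A ((fun x => p x a) @^-1` S)) /\
  (forall a (B : set (nat -> A)), cyl_sigma A B ->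
     P (X 0 @^-1` [set a] `&` past_of X (-1) @^-1` B) =
     (\int[P]_(w in past_of X (-1) @^-1` B) (p (past_of X (-1) w) a)%:E)%E).

Definition natfilt_fin (A : finType) (X : int -> Omega -> A) (n : int) : set (set Omega) :=
  <<s [set E | exists (k : int) (S : set A), k <= n /\ E = X k @^-1` S] >>.

Definition natfilt_R (U : int -> Omega -> R) (n : int) : set (set Omega) :=
  <<s [set E | exists (k : int) (S : set R), k <= n /\ measurable S /\ E = U k @^-1` S] >>.

Definition is_cond_exp (P : probability Omega R) (G : set (set Omega)) (f g : Omega -> R) :=
  (forall S : set R, measurable S -> G (g @^-1` S)) /\
  P.-integrable setT (EFin \o g) /\
  forall B, G B -> (\int[P]_(w in B) (g w)%:E = \int[P]_(w in B) (f w)%:E)%E.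

Definition cond_indep (P : probability Omega R) (H1 H2 G : set (set Omega)) :=
  forall E1 E2, H1 E1 -> H2 E2 ->
  forall g1 g2 g12 : Omega -> R,
    is_cond_exp P G (\1_E1) g1 -> is_cond_exp P G (\1_E2) g2 ->
    is_cond_exp P G (\1_(E1 `&` E2)) g12 ->
    {ae P, forall w, g12 w = g1 w * g2 w}.

(* F is immersed in G (sigma-fields taken up to P-null sets, i.e. completed). *)
Definition immersed (P : probability Omega R) (F G : int -> set (set Omega)) :=
  (forall n E, F n E -> exists E', G n E' /\
     exists N, [/\ measurable N, P N = 0%E & (E `\` E') `|` (E' `\` E) `<=` N]) /\
  (forall n, cond_indep P (F (n + 1)) (G n) (F n)).

Definition iid (P : probability Omega R) (U : int -> Omega -> R) :=
  (forall n, measurable_fun setT (U n)) /\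
  (forall n (S : set R), measurable S -> P (U n @^-1` S) = P (U 0 @^-1` S)) /\
  (forall (s : seq int) (S : int -> set R), uniq s -> (forall i, measurable (S i)) ->
     P (\bigcap_(i in [set` s]) U i @^-1` S i) = (\prod_(i <- s) P (U i @^-1` S i))%E).

End Prob.

(* F^X is standard: possibly after enlarging the probability space (Omega', P')
   --pi--> (Omega, P), the filtration of X o pi is immersed in the natural
   filtration of some i.i.d. process. *)
Definition standard (d : measure_display) (Omega : measurableType d) (R : realType)
    (P : probability Omega R) (A : finType) (X : int -> Omega -> A) : Prop :=
  exists (d' : measure_display) (Omega' : measurableType d') (P' : probability Omega' R)
         (pi : Omega' -> Omega) (U : int -> Omega' -> R),
    [/\ measurable_fun setT pi,
        (forall E, measurable E -> P' (pi @^-1` E) = P E),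
        iid P' U &
        immersed P' (natfilt_fin (fun n => X n \o pi)) (natfilt_R U)].

(* Main.v *)
Require Import Defs.
From HB Require Import structures.
From mathcomp Require Import all_boot all_order all_algebra.
From mathcomp Require Import all_classical all_reals all_analysis.
From mathcomp Require Import measurable_realfun ring lra zify.
Import Order.TTheory GRing.Theory Num.Theory.
Import numFieldNormedType.Exports.
Local Open Scope classical_set_scope.
Local Open Scope ring_scope.

(** The process is realised as X_n = f(X_{<n}, U_n), where U_n is uniform and
    independent of the past and where f sends two pasts x and y to different
    letters with probability at most c ||p(.|x) - p(.|y)||.  For two letters the
    quantile coupling gives c = 1; in general rejection sampling with common darts
    gives c = 2.

    Run the recursion from a fixed past at a remote time with the same U_n.  The
    length of agreement with X grows from l to l+1 with conditional probability at
    least 1 - c delta_l, so it dominates the chain on the naturals which jumps from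
    l to l+1 with probability 1 - c delta_l and falls to 0 otherwise.  The
    probability u_j of finding this chain at 0 at time j is nonincreasing, and the
    decomposition by the last visit to 0 yields
    u_j * sum_{k <= j} prod_{n < k} (1 - c delta_n) <= 1.  The divergence of the
    series therefore forces u_j -> 0, and X_n is a function of (U_k)_{k <= n}.

    On Omega x [0,1], U_n is drawn from X and an independent uniform variable W_n
    as a uniform variable conditioned on f(X_{<n}, .) = X_n.  An event of the past
    of U then depends on (X_k)_{k <= n} and on noise independent of X, which gives
    the immersion.  The sequence (W_n) is read off the binary digits of a single
    uniform variable. *)

Set Implicit Arguments.
Unset Strict Implicit.
Unset Printing Implicit Defensive.

(** * Real-valued probabilities and the uniform law *)

(** [delta] is a supremum over all pasts, not over almost all of them. The coupling bound therefore
    holds for the arbitrary constant past that starts the recursion, even if [X] never displays such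
    a past.

    The process has no first time, so the recursion alone does not express [X] through the noise: it
    must be shown that the influence of the remote past dies out. Monotonicity of [delta] enters
    here: a longer agreement is less likely to be broken, which makes the comparison chain
    stochastically monotone and u_j nonincreasing.

    The noise U_n is built from X_n itself, yet has to be independent of the strict past. The reason
    is a change of order. Drawing a letter from p(.|x) and then a uniform variable conditioned on
    giving this letter yields the same pair as drawing a uniform variable and reading its letter. *)

Section image_measure.
Context d d' (T : measurableType d) (T' : measurableType d') (R : realType).
Variables (m : {measure set T -> \bar R}) (f : T -> T').
Hypothesis mf : measurable_fun setT f.

Definition image_measure : {measure set T' -> \bar R} :=
  measure_function_pushforward__canonical__measure_function_Measure m mf.

Lemma image_measureE B : image_measure B = m (f @^-1` B). Proof. by []. Qed.

End image_measure.

Section measure_uniqueness.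
Context d (T : measurableType d) (R : realType).

Lemma measure_unique_sub_sigma (G : set (set T))
    (m1 m2 : {measure set T -> \bar R}) :
  G `<=` measurable -> setI_closed G -> (m1 setT < +oo)%E ->
  m1 setT = m2 setT -> (forall B, G B -> m1 B = m2 B) ->
  forall B, <<s G >> B -> m1 B = m2 B.
Proof.
move=> Gm GI m1oo mT mG B GB.
(* Adding [setT] keeps the family stable under intersection and supplies the exhausting sequence
   that the uniqueness theorem asks for. *)
pose G' := [set A | G A \/ A = setT].
have sub : <<s G >> `<=` <<s G' >>.
  apply: smallest_sub; first exact: smallest_sigma_algebra.
  by move=> C GC; apply: sub_sigma_algebra; left.
apply: (@g_sigma_algebra_measure_unique _ _ _ G' _ (fun=> setT)) => //.
- by move=> C [/Gm//|->].
- by move=> _; right.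
- by apply/seteqP; split=> // x _; exists 0%N.
- move=> C D [GC|->] [GD|->]; rewrite ?setIT ?setTI; try by left.
  + by left; apply: GI.
  + by right.
- by move=> C [/mG//|->].
- exact: sub.
Qed.

End measure_uniqueness.

Section real_probability.
Context d (T : measurableType d) (R : realType).
Implicit Types (P : probability T R) (A B : set T).

(** Real values make probabilities accessible to [lra] and [nra]. *)
Definition pr P A : R := fine (P A).

Lemma prE P A : measurable A -> P A = (pr P A)%:E.
Proof. by move=> mA; rewrite /pr fineK// fin_num_measure. Qed.

Lemma pr_ge0 P A : 0 <= pr P A.
Proof. exact: fine_ge0. Qed.

Lemma prT P : pr P setT = 1.
Proof. by rewrite /pr probability_setT. Qed.

Lemma pr0 P : pr P set0 = 0.
Proof. by rewrite /pr measure0. Qed.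

Lemma pr_le P A B : measurable A -> measurable B -> A `<=` B ->
  pr P A <= pr P B.
Proof.
move=> mA mB AB; rewrite -lee_fin -!prE//.
by apply: le_measure => //; rewrite inE.
Qed.

Lemma pr_le1 P A : measurable A -> pr P A <= 1.
Proof. by move=> mA; rewrite -(prT P) pr_le. Qed.

Lemma prU P A B : measurable A -> measurable B -> A `&` B = set0 ->
  pr P (A `|` B) = pr P A + pr P B.
Proof.
move=> mA mB AB; apply: EFin_inj.
by rewrite -prE ?measureU//; [rewrite EFinD -!prE|exact: measurableU].
Qed.

Lemma prU_le P A B : measurable A -> measurable B ->
  pr P (A `|` B) <= pr P A + pr P B.
Proof.
move=> mA mB; rewrite -lee_fin EFinD -!prE//; last exact: measurableU.
exact: measureU2.
Qed.

Lemma pr_split P A B : measurable A -> measurable B ->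
  pr P A = pr P (A `&` B) + pr P (A `&` ~` B).
Proof.
move=> mA mB; have mB' := measurableC mB.
rewrite -prU; [|exact: measurableI|exact: measurableI|].
  by rewrite -setIUr setUv setIT.
by rewrite setIACA setICr setI0.
Qed.

Lemma prC P A : measurable A -> pr P (~` A) = 1 - pr P A.
Proof.
move=> mA; have := pr_split P measurableT mA.
by rewrite !setTI prT => ->; rewrite addrAC subrr add0r.
Qed.

Lemma pr_fin_split (I : finType) (F : I -> set T) P A :
  measurable A -> (forall i, measurable (F i)) ->
  (forall i j w, F i w -> F j w -> i = j) ->
  (forall w, exists i, F i w) ->
  pr P A = \sum_i pr P (A `&` F i).
Proof.
move=> mA mF disj cov.
have mAF i : measurable (A `&` F i) by exact: measurableI.
suff H : forall s : seq I, uniq s ->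
    pr P (A `&` [set w | exists2 i, i \in s & F i w]) =
    \sum_(i <- s) pr P (A `&` F i).
  have := H (index_enum I) (index_enum_uniq I) => <-.
  congr pr; apply/seteqP; split=> w /=; last by case.
  by have [i Fi] := cov w; split => //; exists i => //; exact: mem_index_enum.
elim=> [_|i s IH /= /andP[iNs us]].
  by rewrite big_nil -[RHS](pr0 P); congr pr; apply/seteqP; split=> w //= [_ []].
have mS (s' : seq I) : measurable [set w | exists2 i, i \in s' & F i w].
  rewrite [X in measurable X](_ : _ = \bigcup_(i in [set` s']) F i) //.
  exact: fin_bigcup_measurable.
rewrite big_cons -IH// -prU//; [|exact: measurableI|].
- congr pr; apply/seteqP; split=> w /=.
    move=> [Aw [j]]; rewrite inE => /orP[/eqP->|js Fj]; [left|right] => //.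
    by split => //; exists j.
  move=> [[Aw Fi]|[Aw [j js Fj]]]; split => //.
    by exists i => //; rewrite mem_head.
  by exists j => //; rewrite inE js orbT.
- apply/seteqP; split=> w //= [[_ Fi] [_ [j js Fj]]].
  by rewrite (disj _ _ _ Fi Fj) js in iNs.
Qed.

End real_probability.

Section pr_uniqueness.
Context (R : realType) d1 d2 d (T1 : measurableType d1) (T2 : measurableType d2)
  (T : measurableType d).
Variables (P1 : probability T1 R) (P2 : probability T2 R).
Variables (X1 : T1 -> T) (X2 : T2 -> T).
Hypotheses (mX1 : measurable_fun setT X1) (mX2 : measurable_fun setT X2).
Variables (E1 : set T1) (E2 : set T2) (c1 c2 : R).
Hypotheses (mE1 : measurable E1) (mE2 : measurable E2).
Hypotheses (c1_ge0 : 0 <= c1) (c2_ge0 : 0 <= c2).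
Hypothesis total : c1 * pr P1 E1 = c2 * pr P2 E2.

Let m1 : {measure set T -> \bar R} :=
  mscale (NngNum c1_ge0) (image_measure (mrestr P1 mE1) mX1).
Let m2 : {measure set T -> \bar R} :=
  mscale (NngNum c2_ge0) (image_measure (mrestr P2 mE2) mX2).

Let mpre1 B : measurable B -> measurable (X1 @^-1` B).
Proof. by move=> mB; rewrite -[X in measurable X]setTI; exact: mX1. Qed.

Let mpre2 B : measurable B -> measurable (X2 @^-1` B).
Proof. by move=> mB; rewrite -[X in measurable X]setTI; exact: mX2. Qed.

Let m1E B : measurable B -> m1 B = (c1 * pr P1 (X1 @^-1` B `&` E1))%:E.
Proof.
move=> mB; rewrite EFinM -prE//; apply: measurableI => //; exact: mpre1.
Qed.

Let m2E B : measurable B -> m2 B = (c2 * pr P2 (X2 @^-1` B `&` E2))%:E.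
Proof.
move=> mB; rewrite EFinM -prE//; apply: measurableI => //; exact: mpre2.
Qed.

(** The weights and the events cover equality in law and independence at once: for [c1 = 1],
    [E2 = setT] and [c2 = pr P1 E1], the conclusion says that [X1] is independent of [E1] and
    distributed as [X2]. *)
Lemma pr_unique_sub_sigma (G : set (set T)) :
  G `<=` measurable -> setI_closed G ->
  (forall B, G B -> c1 * pr P1 (X1 @^-1` B `&` E1) =
                    c2 * pr P2 (X2 @^-1` B `&` E2)) ->
  forall B, <<s G >> B -> c1 * pr P1 (X1 @^-1` B `&` E1) =
                          c2 * pr P2 (X2 @^-1` B `&` E2).
Proof.
move=> Gm GI GE B GB.
have mB : measurable B.
  by move: B GB; apply: smallest_sub => //; exact: sigma_algebra_measurable.
apply: EFin_inj; rewrite -m1E// -m2E//.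
apply: (@measure_unique_sub_sigma _ _ _ G) => //.
- by rewrite m1E// ltry.
- by rewrite m1E// m2E// !preimage_setT !setTI total.
- by move=> C GC; rewrite m1E ?m2E ?GE//; exact: Gm.
Qed.

End pr_uniqueness.

Section unif.
Context (R : realType).
Implicit Types (x y : R) (S : set R).

Lemma measurableR_rays : (@measurable _ R) `<=` <<s range (fun x : R => `]-oo, x]%classic) >>.
Proof.
have -> : @measurable _ R = (@ocitv R).-sigma.-measurable by [].
rewrite RGenOInfty.measurableE; apply: smallest_sub.
  exact: smallest_sigma_algebra.
move=> _ [x ->]; rewrite -[X in _ X]setCK; apply: sigma_algebraC.
by rewrite setCitvr; apply: sub_sigma_algebra; exists x.
Qed.

Lemma setI_closed_rays : setI_closed (range (fun x : R => `]-oo, x]%classic)).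
Proof.
move=> _ _ [x _ <-] [y _ <-]; exists (Num.min x y) => //.
by apply/seteqP; split => z /=; rewrite !in_itv /= le_min => /andP.
Qed.

Lemma pr_unique_cdf d1 d2 (T1 : measurableType d1) (T2 : measurableType d2)
    (P1 : probability T1 R) (P2 : probability T2 R) (X1 : T1 -> R) (X2 : T2 -> R)
    (E1 : set T1) (E2 : set T2) (c1 c2 : R) :
  measurable_fun setT X1 -> measurable_fun setT X2 ->
  measurable E1 -> measurable E2 -> 0 <= c1 -> 0 <= c2 ->
  c1 * pr P1 E1 = c2 * pr P2 E2 ->
  (forall x, c1 * pr P1 (X1 @^-1` `]-oo, x] `&` E1) =
             c2 * pr P2 (X2 @^-1` `]-oo, x] `&` E2)) ->
  forall S, measurable S -> c1 * pr P1 (X1 @^-1` S `&` E1) =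
                            c2 * pr P2 (X2 @^-1` S `&` E2).
Proof.
move=> mX1 mX2 mE1 mE2 c10 c20 tot ray S mS.
apply: (pr_unique_sub_sigma mX1 mX2 mE1 mE2 c10 c20 tot
  (G := range (fun x : R => `]-oo, x]%classic))).
- by move=> _ [x _ <-].
- exact: setI_closed_rays.
- by move=> _ [x _ <-]; exact: ray.
- exact: measurableR_rays.
Qed.

Definition unif_fun : set R -> \bar R := uniform_prob (@ltr01 R).

Let unif0 : unif_fun set0 = 0%E. Proof. exact: measure0. Qed.

Let unif_ge0 S : (0 <= unif_fun S)%E. Proof. exact: measure_ge0. Qed.

Let unif_sigma_additive : semi_sigma_additive unif_fun.
Proof. exact: (@measure_semi_sigma_additive _ _ _ (uniform_prob (@ltr01 R))). Qed.

HB.instance Definition _ := isMeasure.Build _ R R unif_fun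
  unif0 unif_ge0 unif_sigma_additive.

Let unif_setT : unif_fun setT = 1%E. Proof. exact: probability_setT. Qed.

HB.instance Definition _ := Measure_isProbability.Build _ _ R unif_fun unif_setT.

Definition unif : probability R R := unif_fun.

Definition clamp x : R := if x <= 0 then 0 else if x <= 1 then x else 1.

Lemma unif_cdf x : pr unif `]-oo, x]%classic = clamp x.
Proof.
rewrite /pr /unif /= /unif_fun /uniform_prob integral_uniform_pdf.
have -> : `]-oo, x] `&` `[0, 1] = `[0, Num.min x 1]%classic.
  apply/seteqP; split => z /=; rewrite !in_itv /= le_min.
    by move=> [-> /andP[-> ->]].
  by move=> /and3P[-> -> ->].
rewrite (eq_integral (fun=> 1%E)); last first.
  move=> z; rewrite inE /= in_itv /= le_min /uniform_pdf => /and3P[-> _ ->] /=.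
  by rewrite subr0 invr1.
rewrite integral_cst//= mul1e lebesgue_measure_itv/= lte_fin lt_min ltr01 andbT.
rewrite /clamp; case: (leP x 0) => x0 //=.
by rewrite subr0; case: (leP x 1).
Qed.

End unif.

(** * Splitting a uniform variable into two independent ones *)

Section split.
Context (R : realType).
Implicit Types (u x y : R) (S : set R) (b : bool).

Definition bit u : bool := 2^-1 < u.

(** The shift on binary digits. *)
Definition dbl u : R := 2 * u - (bit u)%:R.

Lemma measurable_bit b : measurable [set u | bit u = b].
Proof.
have mt : measurable [set u | bit u = true].
  rewrite [X in measurable X](_ : _ = `]2^-1, +oo[%classic) //.
  by apply/seteqP; split=> u /=; rewrite in_itv /= andbT.
case: b => //.
have -> : [set u | bit u = false] = ~` [set u | bit u = true].
  by apply/seteqP; split=> u /=; case: (bit u).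
exact: measurableC.
Qed.

Lemma measurable_bitR : measurable_fun setT (fun u => (bit u)%:R : R).
Proof.
rewrite [X in measurable_fun _ X](_ : _ = \1_[set u | bit u = true]).
  by apply: measurable_indic; exact: measurable_bit.
by apply/funext => u; rewrite indicE; case: (boolP (bit u)) => h;
  [rewrite mem_set|rewrite memNset //= => /(negP h)].
Qed.

Lemma measurable_dbl : measurable_fun setT dbl.
Proof.
apply: measurable_funB; last exact: measurable_bitR.
exact: measurable_funM.
Qed.

Lemma bit_false_ray : [set u | bit u = false] = `]-oo, 2^-1]%classic.
Proof.
by apply/seteqP; split=> u /=; rewrite in_itv /= leNgt -/(bit u); case: (bit u).
Qed.

(** The uniform masses of the two preimages of the ray up to [x] under [dbl]: here for leading digit
    0, in [clamp_halfS] for leading digit 1. *)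
Lemma clamp_half x : clamp x / 2 = Num.min (clamp (x / 2)) 2^-1.
Proof.
by rewrite /clamp; repeat (case: ifPn; rewrite -?ltNge => * ); case: leP => *; lra.
Qed.

Lemma clamp_halfS x :
  clamp x / 2 = clamp ((x + 1) / 2) - Num.min (clamp ((x + 1) / 2)) 2^-1.
Proof.
by rewrite /clamp; repeat (case: ifPn; rewrite -?ltNge => * ); case: leP => *; lra.
Qed.

Lemma pr_unif_ray_half x :
  pr (unif R) (`]-oo, x] `&` `]-oo, 2^-1]) = Num.min (clamp x) 2^-1.
Proof.
have -> : `]-oo, x] `&` `]-oo, 2^-1] = `]-oo, Num.min x 2^-1]%classic.
  by apply/seteqP; split => z /=; rewrite !in_itv /= le_min => /andP.
rewrite unif_cdf /clamp.
case: (leP x 2^-1) => xh; repeat (case: ifPn; rewrite -?ltNge => * );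
  case: leP => *; lra.
Qed.

Lemma pr_bit b : pr (unif R) [set u | bit u = b] = 2^-1.
Proof.
have hf : pr (unif R) [set u | bit u = false] = 2^-1.
  rewrite bit_false_ray unif_cdf /clamp.
  by repeat (case: ifPn; rewrite -?ltNge => * ); lra.
case: b => //.
have -> : [set u | bit u = true] = ~` [set u | bit u = false].
  by apply/seteqP; split=> u /=; case: (bit u).
by rewrite prC ?hf; [lra|exact: measurable_bit].
Qed.

(** Doubling maps each half of the unit interval affinely onto the whole, so the remaining digits
    are uniform and independent of the first one. Only rays need checking. *)
Lemma pr_dbl_bit b S : measurable S ->
  pr (unif R) (dbl @^-1` S `&` [set u | bit u = b]) = 2^-1 * pr (unif R) S.
Proof.
move=> mS.
rewrite -[LHS]mul1r -[S in RHS]setIT -[S in RHS]preimage_id.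
apply: pr_unique_cdf => //; first exact: measurable_dbl.
- exact: measurable_bit.
- by rewrite pr_bit prT mulr1 mul1r.
- move=> x; rewrite setIT preimage_id unif_cdf mul1r.
  case: b.
    have -> : dbl @^-1` `]-oo, x] `&` [set u | bit u = true] =
        `]-oo, (x + 1) / 2] `&` ~` `]-oo, 2^-1].
      apply/seteqP; split=> u /=; rewrite !in_itv /= /dbl.
        move=> [h bu]; move: h; rewrite bu /= => h; split; first lra.
        by apply/negP; rewrite -ltNge.
      by move=> [h /negP]; rewrite -ltNge => bu; rewrite /bit bu; split => //=; lra.
    have := pr_split (unif R) (measurable_itv `]-oo, (x + 1) / 2])
      (measurable_itv `]-oo, 2^-1]).
    by rewrite unif_cdf pr_unif_ray_half; have := clamp_halfS x; lra.
  have -> : dbl @^-1` `]-oo, x] `&` [set u | bit u = false] =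
      `]-oo, x / 2] `&` `]-oo, 2^-1].
    apply/seteqP; split=> u /=; rewrite !in_itv /= /dbl.
      move=> [h bu]; move: h; rewrite bu /= => h.
      by split; [lra|rewrite leNgt; exact/negbT].
    by rewrite (leNgt u 2^-1) => -[h /negbTE bu]; rewrite /bit bu; split => //=; lra.
  by rewrite pr_unif_ray_half -clamp_half mulrC.
Qed.

Lemma measurable_pre_dbl S : measurable S -> measurable (dbl @^-1` S).
Proof. by move=> mS; rewrite -[X in measurable X]setTI; exact: measurable_dbl. Qed.

Lemma pr_bit_sum S : measurable S -> pr (unif R) S =
  pr (unif R) (S `&` [set u | bit u = false]) +
  pr (unif R) (S `&` [set u | bit u = true]).
Proof.
move=> mS; rewrite (pr_split _ mS (measurable_bit false)); congr (_ + pr _ (_ `&` _)).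
by apply/seteqP; split=> u /=; case: (bit u).
Qed.

Definition dbl2 u := dbl (dbl u).

(* The first [n] even-indexed binary digits of [u], as a dyadic number. *)
Fixpoint even_digits n u : R :=
  if n is m.+1 then ((bit u)%:R + even_digits m (dbl2 u)) / 2 else 0.

Lemma even_digits_itv n u : 0 <= even_digits n u <= 1.
Proof.
elim: n u => [|n IH] u /=; first by rewrite lexx ler01.
by have := IH (dbl2 u); case: (bit u) => /=; lra.
Qed.

Lemma even_digits_homo u : nondecreasing_seq (even_digits ^~ u).
Proof.
apply/nondecreasing_seqP => n; elim: n u => [|n IH] u.
  by have /andP[] := even_digits_itv 1 u.
by rewrite [even_digits n.+2]/= [even_digits n.+1]/= ler_pM2r// lerD2l IH.
Qed.

Definition even_bits u : R := limn (even_digits ^~ u).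

(** Dropping the leading digit exchanges the parities. *)
Definition odd_bits u : R := even_bits (dbl u).

Lemma even_digits_cvg u : even_digits ^~ u @ \oo --> even_bits u.
Proof.
apply: nondecreasing_is_cvgn; first exact: even_digits_homo.
by exists 1 => _ [n _ <-]; case/andP: (even_digits_itv n u).
Qed.

Lemma even_bits_itv u : 0 <= even_bits u <= 1.
Proof.
have cv : cvgn (even_digits ^~ u) by apply/cvg_ex; exists (even_bits u); exact: even_digits_cvg.
apply/andP; split.
  by apply: limr_ge => //; apply: nearW => n; case/andP: (even_digits_itv n u).
by apply: limr_le => //; apply: nearW => n; case/andP: (even_digits_itv n u).
Qed.

(** The recursion of the approximations passes to the limit. This self-similarity is what turns the
    law of the pair into a functional equation. *)
Lemma even_bitsE u : even_bits u = ((bit u)%:R + even_bits (dbl2 u)) / 2.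
Proof.
apply: cvg_lim => //; rewrite -cvg_shiftS /=.
apply: cvgM; last exact: cvg_cst.
by apply: cvgD; [exact: cvg_cst|exact: even_digits_cvg].
Qed.

Lemma measurable_even_bits : measurable_fun setT even_bits.
Proof.
apply: (@measurable_fun_cvg _ _ _ _ even_digits); last first.
  by move=> u _; exact: even_digits_cvg.
elim=> [|n IH] /=; first exact: measurable_cst.
apply: measurable_funM; last exact: measurable_cst.
apply: measurable_funD; first exact: measurable_bitR.
apply: (measurableT_comp IH); apply: measurableT_comp; exact: measurable_dbl.
Qed.

Lemma measurable_odd_bits : measurable_fun setT odd_bits.
Proof. exact: measurableT_comp measurable_even_bits measurable_dbl. Qed.

(** A bound M for |f| valid everywhere improves to M/2, since each value is 0 or at most half of
    another value in modulus. Applied to the difference of two bounded solutions of a self-similar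
    equation, this gives uniqueness. *)
Lemma halving_eq0 (I : Type) (f : I -> R) :
  (forall i, -1 <= f i <= 1) ->
  (forall i, f i = 0 \/ exists j c, 0 <= c <= 2^-1 /\ f i = c * f j) ->
  forall i, f i = 0.
Proof.
move=> f1 fh.
have P n : (0 : R) <= 2^-1 ^+ n by apply: exprn_ge0; lra.
have B n i : - 2^-1 ^+ n <= f i <= 2^-1 ^+ n.
  elim: n i => [|n IH] i; first by rewrite expr0; exact: f1.
  have [->|[j [c [c01 ->]]]] := fh i; first by have := P n.+1; lra.
  by have := IH j; have := P n; rewrite exprS; nra.
move=> i; apply/eqP; rewrite -normr_eq0 eq_le normr_ge0 andbT.
have cv : (fun n : nat => 2^-1 ^+ n : R) @ \oo --> 0.
  by apply: cvg_expr; rewrite gtr0_norm; lra.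
rewrite -(cvg_lim _ cv)//; apply: limr_ge; first by apply/cvg_ex; exists 0.
by apply: nearW => n; rewrite ler_norml B.
Qed.

Lemma clamp_le0 x : x < 0 -> clamp x = 0.
Proof. by move=> x0; rewrite /clamp ltW. Qed.

Lemma clamp_ge1 x : 1 <= x -> clamp x = 1.
Proof.
by move=> x1; rewrite /clamp; repeat (case: ifPn; rewrite -?ltNge => * ); lra.
Qed.

Lemma clamp_itv x : 0 <= clamp x <= 1.
Proof. by rewrite /clamp; repeat (case: ifPn; rewrite -?ltNge => * ); lra. Qed.

Lemma clamp_double x : clamp x = 2^-1 * (clamp (2 * x) + clamp (2 * x - 1)).
Proof. by rewrite /clamp; repeat (case: ifPn; rewrite -?ltNge => * ); lra. Qed.

(** At each point of [0, 1) one of the arguments [2 * x] and [2 * x - 1] lies where the boundary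
    values fix both functions, so the difference [h - clamp] is half its value at the other
    argument. *)
Lemma clamp_unique (h : R -> R) : (forall x, 0 <= h x <= 1) ->
  (forall x, x < 0 -> h x = 0) -> (forall x, 1 <= x -> h x = 1) ->
  (forall x, h x = 2^-1 * (h (2 * x) + h (2 * x - 1))) -> h =1 @clamp R.
Proof.
move=> h01 h0 h1 hd x; apply/eqP; rewrite -subr_eq0; apply/eqP.
apply: (@halving_eq0 _ (fun x => h x - clamp x)) => {}x.
  by have := h01 x; have := clamp_itv x; lra.
have [x0|x0] := ltP x 0; first by left; rewrite h0// clamp_le0// subrr.
have [x1|x1] := leP 1 x; first by left; rewrite h1// clamp_ge1// subrr.
right; have [xh|xh] := ltP x 2^-1.
  exists (2 * x), 2^-1; split; first lra.
  rewrite hd clamp_double (h0 (2 * x - 1)) ?(@clamp_le0 (2 * x - 1)); lra.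
exists (2 * x - 1), 2^-1; split; first lra.
rewrite hd clamp_double (h1 (2 * x)) ?(@clamp_ge1 (2 * x)); lra.
Qed.

(* [H] is the joint distribution function of the two halves.  Reading two digits
   gives [H_step], and the product of the two uniform distribution functions is
   its only bounded solution with the right boundary values. *)
Let H x y := pr (unif R) (even_bits @^-1` `]-oo, x] `&` odd_bits @^-1` `]-oo, y]).

Let mpre1 S : measurable S -> measurable (even_bits @^-1` S).
Proof. by move=> mS; rewrite -[X in measurable X]setTI; exact: measurable_even_bits. Qed.

Let mpre2 S : measurable S -> measurable (odd_bits @^-1` S).
Proof. by move=> mS; rewrite -[X in measurable X]setTI; exact: measurable_odd_bits. Qed.

Let mH x y : measurable (even_bits @^-1` `]-oo, x] `&` odd_bits @^-1` `]-oo, y]).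
Proof. by apply: measurableI; [exact: mpre1|exact: mpre2]. Qed.

Let pr_two_bits S b (c : bool) : measurable S ->
  pr (unif R) ((dbl2 @^-1` S `&` [set u | bit (dbl u) = c]) `&`
    [set u | bit u = b]) = 4^-1 * pr (unif R) S.
Proof.
move=> mS.
have -> : dbl2 @^-1` S `&` [set u | bit (dbl u) = c] =
    dbl @^-1` (dbl @^-1` S `&` [set u | bit u = c]) by [].
rewrite !pr_dbl_bit//; first by lra.
by apply: measurableI; [exact: measurable_pre_dbl|exact: measurable_bit].
Qed.

Let H_step x y : H x y =
  4^-1 * (H (2 * x) (2 * y) + H (2 * x) (2 * y - 1) +
          H (2 * x - 1) (2 * y) + H (2 * x - 1) (2 * y - 1)).
Proof.
have Hbc b (c : bool) : pr (unif R) ((even_bits @^-1` `]-oo, x] `&` odd_bits @^-1` `]-oo, y])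
      `&` [set u | bit u = b] `&` [set u | bit (dbl u) = c]) =
    4^-1 * H (2 * x - b%:R) (2 * y - c%:R).
  rewrite -(pr_two_bits b c) //; congr pr.
  have E1 u : bit u = b -> (even_bits u <= x) = (even_bits (dbl2 u) <= 2 * x - b%:R).
    by rewrite even_bitsE => ->; apply/idP/idP; lra.
  have E2 u : bit (dbl u) = c ->
      (odd_bits u <= y) = (odd_bits (dbl2 u) <= 2 * y - c%:R).
    by rewrite /odd_bits (even_bitsE (dbl u)) => ->; apply/idP/idP; rewrite /dbl2; lra.
  apply/seteqP; split=> u /=; rewrite !in_itv /=.
    by move=> [[[h1 h2] hb] hc]; rewrite -E1// -E2.
  by move=> [[[h1 h2] hc] hb]; rewrite E1// E2.
rewrite {1}/H pr_bit_sum//.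
have mB b : measurable ((even_bits @^-1` `]-oo, x] `&` odd_bits @^-1` `]-oo, y])
      `&` [set u | bit u = b]).
  by apply: measurableI => //; exact: measurable_bit.
have mb2 : measurable [set u | bit (dbl u) = false].
  by apply: (measurable_pre_dbl (measurable_bit false)).
have C : ~` [set u | bit (dbl u) = false] = [set u | bit (dbl u) = true].
  by apply/seteqP; split=> u /=; case: (bit (dbl u)).
rewrite (pr_split _ (mB false) mb2) (pr_split _ (mB true) mb2) !C !Hbc /=.
by rewrite !subr0 !mulrDr; lra.
Qed.

Let H_le0l x y : x < 0 -> H x y = 0.
Proof.
move=> x0; rewrite -(pr0 (unif R)); congr pr; apply/seteqP; split=> // u [] /=.
by rewrite !in_itv /=; have := even_bits_itv u; lra.
Qed.

Let H_le0r x y : y < 0 -> H x y = 0.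
Proof.
move=> x0; rewrite -(pr0 (unif R)); congr pr; apply/seteqP; split=> // u [] /=.
by rewrite !in_itv /= /odd_bits; have := even_bits_itv (dbl u); lra.
Qed.

Let H_ge1l x y : 1 <= x -> H x y = H 1 y.
Proof.
move=> x1; congr pr; apply/seteqP; split=> u [] /=; rewrite !in_itv /= => _ ?;
  by split => //; have := even_bits_itv u; lra.
Qed.

Let H_ge1r x y : 1 <= y -> H x y = H x 1.
Proof.
move=> x1; congr pr; apply/seteqP; split=> u [] /=; rewrite !in_itv /= => ? _;
  by split => //; rewrite /odd_bits; have := even_bits_itv (dbl u); lra.
Qed.

Let H11 : H 1 1 = 1.
Proof.
rewrite -[RHS](prT (unif R)); congr pr; apply/seteqP; split=> // u _.
rewrite /= !in_itv /= /odd_bits.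
by have := even_bits_itv u; have := even_bits_itv (dbl u); split; lra.
Qed.

Let H01 x y : 0 <= H x y <= 1.
Proof. by rewrite pr_ge0 pr_le1. Qed.

(** At first argument 1, both [2 * 1] and [2 * 1 - 1] give [H 1], so the four terms of [H_step]
    collapse to the two-term equation of [clamp_unique]. *)
Let H1r y : H 1 y = clamp y.
Proof.
apply: (@clamp_unique (H 1)) => [{}y|{}y|{}y y1|{}y]; first exact: H01.
- exact: H_le0r.
- by rewrite H_ge1r// H11.
- rewrite H_step !(@H_ge1l (2 * 1)); try lra.
  by rewrite (_ : 2 * 1 - 1 = 1 :> R); lra.
Qed.

Let H1l x : H x 1 = clamp x.
Proof.
apply: (@clamp_unique (H ^~ 1)) => [{}x|{}x|{}x x1|{}x]; first exact: H01.
- exact: H_le0l.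
- by rewrite H_ge1l// H11.
- rewrite H_step !(@H_ge1r _ (2 * 1)); try lra.
  by rewrite (_ : 2 * 1 - 1 = 1 :> R); lra.
Qed.

Let HE x y : H x y = clamp x * clamp y.
Proof.
pose D (z : R * R) := H z.1 z.2 - clamp z.1 * clamp z.2.
suff : D (x, y) = 0 by rewrite /D /=; lra.
have Dx0 u v : u < 0 -> D (u, v) = 0.
  by move=> u0; rewrite /D /= H_le0l// clamp_le0//; lra.
have Dy0 u v : v < 0 -> D (u, v) = 0.
  by move=> v0; rewrite /D /= H_le0r// (clamp_le0 v0)//; lra.
have Dx1 u v : 1 <= u -> D (u, v) = 0.
  by move=> u1; rewrite /D /= H_ge1l// H1r (clamp_ge1 u1)//; lra.
have Dy1 u v : 1 <= v -> D (u, v) = 0.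
  by move=> v1; rewrite /D /= H_ge1r// H1l (clamp_ge1 v1)//; lra.
have Dst u v : D (u, v) = 4^-1 * (D (2 * u, 2 * v)%R + D (2 * u, 2 * v - 1)%R +
    D (2 * u - 1, 2 * v)%R + D (2 * u - 1, 2 * v - 1)%R).
  by rewrite /D /= H_step (clamp_double u) (clamp_double v); lra.
apply: (@halving_eq0 _ D) => -[u v].
  rewrite /D /=.
  by move: (H u v) (clamp u) (clamp v) (H01 u v) (clamp_itv u) (clamp_itv v) => h c c' *; nra.
(* In each quadrant around (1/2, 1/2), three of the four terms have an argument below 0 or at least
   1 and vanish. One term survives, with coefficient 1/4. *)
right; rewrite Dst.
have [uh|uh] := ltP u 2^-1; have [vh|vh] := ltP v 2^-1.
- exists (2 * u, 2 * v)%R, 4^-1; split; first lra.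
  rewrite (Dy0 (2 * u) (2 * v - 1)) ?(Dx0 (2 * u - 1) (2 * v)) ?(Dx0 (2 * u - 1) (2 * v - 1)); lra.
- exists (2 * u, 2 * v - 1)%R, 4^-1; split; first lra.
  rewrite (Dy1 (2 * u) (2 * v)) ?(Dx0 (2 * u - 1) (2 * v)) ?(Dx0 (2 * u - 1) (2 * v - 1)); lra.
- exists (2 * u - 1, 2 * v)%R, 4^-1; split; first lra.
  rewrite (Dy0 (2 * u - 1) (2 * v - 1)) ?(Dx1 (2 * u) (2 * v)) ?(Dx1 (2 * u) (2 * v - 1)); lra.
- exists (2 * u - 1, 2 * v - 1)%R, 4^-1; split; first lra.
  rewrite (Dy1 (2 * u - 1) (2 * v)) ?(Dx1 (2 * u) (2 * v)) ?(Dx1 (2 * u) (2 * v - 1)); lra.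
Qed.

(** From rays to measurable sets one factor at a time: first [S1] is arbitrary against a ray, then
    [S2] against a fixed [S1]. *)
Lemma pr_even_bits_odd_bits S1 S2 : measurable S1 -> measurable S2 ->
  pr (unif R) (even_bits @^-1` S1 `&` odd_bits @^-1` S2) =
  pr (unif R) S1 * pr (unif R) S2.
Proof.
move=> mS1 mS2.
have step1 y S : measurable S ->
    pr (unif R) (even_bits @^-1` S `&` odd_bits @^-1` `]-oo, y]) =
    pr (unif R) `]-oo, y]%classic * pr (unif R) S.
  move=> mS; rewrite -[LHS]mul1r -[S in RHS]setIT -[S in RHS]preimage_id.
  apply: pr_unique_cdf => //.
  - exact: measurable_even_bits.
  - exact: mpre2.
  - exact: pr_ge0.
  - rewrite mul1r prT mulr1 unif_cdf -H1r; congr pr.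
    apply/seteqP; split => u /= => [h|[]//].
    by split => //; rewrite in_itv /=; have := even_bits_itv u; lra.
  - by move=> x; rewrite mul1r setIT preimage_id [LHS]HE !unif_cdf mulrC.
rewrite setIC -[LHS]mul1r -[S2 in RHS]setIT -[S2 in RHS]preimage_id.
apply: pr_unique_cdf => //.
- exact: measurable_odd_bits.
- exact: mpre1.
- exact: pr_ge0.
- have := step1 1 S1 mS1; rewrite unif_cdf clamp_ge1// mul1r prT mul1r mulr1 => <-.
  congr pr; apply/seteqP; split => u /= => [h|[]//].
  by split => //=; rewrite in_itv /= /odd_bits; have := even_bits_itv (dbl u); lra.
- by move=> x; rewrite mul1r setIT preimage_id setIC step1// mulrC.
Qed.

End split.

Arguments even_bits {R} u.
Arguments odd_bits {R} u.

(** * Independent coordinates and first hits *)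

Lemma measurable_preim d d' (T : measurableType d) (T' : measurableType d')
    (f : T -> T') B :
  measurable_fun setT f -> measurable B -> measurable (f @^-1` B).
Proof. by move=> mf mB; rewrite -[X in measurable X]setTI; exact: mf. Qed.

Section coordinates.
Context (R : realType).
Implicit Types (u w : R) (S D : set R).

(** Splitting again and again gives an i.i.d. uniform sequence on a single copy of the unit
    interval, which avoids an infinite product measure. *)
Fixpoint ucoord (j : nat) u : R :=
  if j is i.+1 then ucoord i (odd_bits u) else even_bits u.

Lemma measurable_ucoord j : measurable_fun setT (ucoord j).
Proof.
elim: j => [|j IH]; first exact: measurable_even_bits.
exact: measurableT_comp IH (@measurable_odd_bits R).
Qed.

Lemma pr_even_bits S : measurable S -> pr (unif R) (even_bits @^-1` S) = pr (unif R) S.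
Proof.
move=> mS; have := pr_even_bits_odd_bits mS measurableT.
by rewrite preimage_setT setIT prT mulr1.
Qed.

Lemma pr_odd_bits S : measurable S -> pr (unif R) (odd_bits @^-1` S) = pr (unif R) S.
Proof.
move=> mS; have := pr_even_bits_odd_bits measurableT mS.
by rewrite preimage_setT setTI prT mul1r.
Qed.

Lemma pr_ucoord j S : measurable S -> pr (unif R) (ucoord j @^-1` S) = pr (unif R) S.
Proof.
elim: j => [|j IH] mS; first exact: pr_even_bits.
have := pr_odd_bits (measurable_preim (measurable_ucoord j) mS); by rewrite IH// => <-.
Qed.

Definition ucoord_box (N : nat) (S : nat -> set R) : set R :=
  [set u | forall i, (i < N)%N -> S i (ucoord i u)].

Lemma measurable_ucoord_box N (S : nat -> set R) :
  (forall i, measurable (S i)) -> measurable (ucoord_box N S).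
Proof.
move=> mS; have -> : ucoord_box N S = \bigcap_(i < N) (ucoord i @^-1` S i) by [].
by apply: fin_bigcap_measurable => // i _; apply: measurable_preim (mS i);
  exact: measurable_ucoord.
Qed.

Lemma ucoord_boxS N (S : nat -> set R) : ucoord_box N.+1 S =
  even_bits @^-1` S 0%N `&` odd_bits @^-1` ucoord_box N (fun i => S i.+1).
Proof.
apply/seteqP; split => u /=.
  by move=> Su; split; [exact: (Su 0%N)|move=> i iN; exact: (Su i.+1)].
by move=> [S0 Su] [//|i] iN; exact: Su.
Qed.

Lemma pr_ucoord_box N (S : nat -> set R) : (forall i, measurable (S i)) ->
  pr (unif R) (ucoord_box N S) = \prod_(i < N) pr (unif R) (S i).
Proof.
elim: N S => [|N IH] S mS.
  by rewrite big_ord0 -[RHS](prT (unif R)); congr pr; apply/seteqP; split.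
rewrite ucoord_boxS pr_even_bits_odd_bits//; last exact: measurable_ucoord_box.
by rewrite IH// big_ord_recl.
Qed.

Definition other_coords (j : nat) : set (set R) :=
  <<s [set C | exists i S, [/\ i <> j, measurable S & C = ucoord i @^-1` S] ]>>.

Let boxes j : set (set R) := [set C | exists N (B : nat -> set R),
  [/\ forall i, measurable (B i), B j = setT & C = ucoord_box N B] ].

(** The boxes free in coordinate [j] form a pi-system generating [other_coords j]. On such a box the
    factor of index [j] is the total mass 1, and intersecting with the event on coordinate [j] turns
    it into the mass of [S]. *)
Lemma other_coords_indep j C S : other_coords j C -> measurable S ->
  pr (unif R) (C `&` ucoord j @^-1` S) = pr (unif R) C * pr (unif R) S.
Proof.
move=> jC mS.
have {jC} : <<s boxes j >> C.
  apply: (smallest_sub (@smallest_sigma_algebra _ setT (boxes j)) _ jC).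
  move=> _ [i [B [ij mB ->]]]; apply: sub_sigma_algebra.
  exists i.+1, (fun k => if k == i then B else setT); split.
  - by move=> k; case: ifP.
  - by case: eqP => // /esym.
  - apply/seteqP; split => u /=; last by move=> /(_ i); rewrite eqxx ltnSn; exact.
    by move=> Bu k _; case: eqP => // ->.
have mpre : measurable (ucoord j @^-1` S) by exact: measurable_preim (measurable_ucoord j) mS.
move=> jC; rewrite -[LHS]mul1r [RHS]mulrC -[C in RHS]setIT -[C]preimage_id.
move: C jC; apply: pr_unique_sub_sigma => //.
- exact: pr_ge0.
- by rewrite mul1r pr_ucoord// prT mulr1.
- by move=> _ [N [B [mB _ ->]]]; exact: measurable_ucoord_box.
- move=> _ _ [N [B [mB Bj ->]]] [N' [B' [mB' B'j ->]]].
  exists (maxn N N'), (fun i => (if (i < N)%N then B i else setT) `&`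
    (if (i < N')%N then B' i else setT)); split.
  + by move=> i; apply: measurableI; case: ifP.
  + by rewrite Bj B'j !if_same setIT.
  + apply/seteqP; split => u /=.
      by move=> [Bu B'u] i _; split; case: ifP => // iN; [exact: Bu|exact: B'u].
    move=> H; split=> i iN; have := H i; rewrite leq_max iN ?orbT /= => -[]//.
- move=> _ [N [B [mB Bj ->]]]; rewrite setIT preimage_id mul1r.
  (* The box is lengthened so that [j] is one of its indices. *)
  pose M := maxn N j.+1.
  pose BN i := if (i < N)%N then B i else setT.
  have mBN i : measurable (BN i) by rewrite /BN; case: ifP.
  have BNj : BN j = setT by rewrite /BN Bj if_same.
  pose BS i := if i == j then S else BN i.
  have mBS i : measurable (BS i) by rewrite /BS; case: ifP.
  have -> : ucoord_box N B = ucoord_box M BN.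
    apply/seteqP; split => u /=.
      by move=> Bu i _; rewrite /BN; case: ifP => // iN; exact: Bu.
    by move=> Bu i iN; have := Bu i; rewrite /BN iN leq_max iN; exact.
  have -> : ucoord_box M BN `&` ucoord j @^-1` S = ucoord_box M BS.
    apply/seteqP; split => u /=.
      by move=> [Bu Su] i iM; rewrite /BS; case: eqP => [->//|_]; exact: Bu.
    move=> Bu; split; last by have := Bu j; rewrite leq_max ltnSn orbT /BS eqxx; exact.
    move=> i iM; have := Bu i iM; rewrite /BS; case: eqP => // ->.
    by rewrite BNj.
  rewrite !pr_ucoord_box//.
  have jM : (j < M)%N by rewrite leq_max ltnSn orbT.
  rewrite (bigD1 (Ordinal jM))//= [in RHS](bigD1 (Ordinal jM))//=.
  rewrite BNj prT mul1r {1}/BS eqxx; congr (_ * _); apply: eq_bigr => i ij.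
  by rewrite /BS; case: eqP => // e; case/eqP: ij; apply/val_inj.
Qed.

(* The junk value [0] is taken when no coordinate of [u] lies in [D]. *)
Definition first_hit D u : R :=
  if pselect (exists j, `[< D (ucoord j u) >]) is left e
  then ucoord (ex_minn e) u else 0.

(** Membership becomes a countable union over the index of the hit, the form from which
    measurability is read. *)
Lemma first_hit_in D S u : S (first_hit D u) <->
  (exists j, [/\ D (ucoord j u), forall i, (i < j)%N -> ~ D (ucoord i u) &
                 S (ucoord j u)]) \/
  ((forall j, ~ D (ucoord j u)) /\ S 0).
Proof.
rewrite /first_hit; case: pselect => [e|ne].
  case: ex_minnP => m /asboolP Dm mmin; split.
    move=> Sm; left; exists m; split => // i im Di.
    by have := mmin i; rewrite leqNgt im; move/(_ (asboolT Di)).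
  case=> [[j [Dj jmin Sj]]|[/(_ m)//]].
  suff -> : m = j by [].
  apply/eqP; rewrite eqn_leq mmin ?asboolT//= leqNgt; apply/negP => mj.
  exact: jmin mj Dm.
split=> [S0|[[j [Dj _ _]]|[]//]]; first right.
  by split => // j Dj; apply: ne; exists j; apply/asboolP.
by exfalso; apply: ne; exists j; apply/asboolP.
Qed.

(** Regeneration: once the first dart is rejected, the same search starts afresh on [odd_bits u],
    which is independent of that dart. *)
Lemma first_hitE D u : first_hit D u =
  if `[< D (even_bits u) >] then even_bits u else first_hit D (odd_bits u).
Proof.
set v := (if _ then _ else _); suff : [set v] (first_hit D u) by [].
apply/(first_hit_in D [set v] u); rewrite {}/v.
case: asboolP => D0; first by left; exists 0%N.
have := (first_hit_in D [set first_hit D (odd_bits u)] (odd_bits u)).1 erefl.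
case=> [[j [Dj jmin e]]|[nD e]]; [left|right].
  by exists j.+1; split=> // -[|i]//; exact: jmin.
by split => // -[|j]; [exact: D0|exact: nD].
Qed.

End coordinates.

Section first_hit_measurable.
Context (R : realType) d (Y : measurableType d) (D : set (Y * R)).
Hypothesis mD : measurable D.

(** Joint measurability is required because the accepted set will depend on the past. *)
Lemma measurable_first_hit :
  measurable_fun setT (fun z : Y * R => first_hit [set u | D (z.1, u)] z.2).
Proof.
move=> _ S mS; rewrite setTI.
have mhit j : measurable [set z : Y * R | D (z.1, ucoord j z.2)].
  apply: (@measurable_preim _ _ _ _ (fun z : Y * R => (z.1, ucoord j z.2))) mD.
  apply/measurable_fun_pairP; split; first exact: measurable_fst.
  exact: measurableT_comp (measurable_ucoord j) measurable_snd.
have mS' j : measurable [set z : Y * R | S (ucoord j z.2)].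
  apply: (@measurable_preim _ _ _ _ (fun z : Y * R => ucoord j z.2)) mS.
  exact: measurableT_comp (measurable_ucoord j) measurable_snd.
pose H j := [set z : Y * R | D (z.1, ucoord j z.2)].
have mnH j : measurable (~` H j) by apply: measurableC; exact: mhit.
have -> : (fun z : Y * R => first_hit [set u | D (z.1, u)] z.2) @^-1` S =
  (\bigcup_j (H j `&` (\bigcap_(i < j) ~` H i) `&` [set z : Y * R | S (ucoord j z.2)]))
  `|` ((\bigcap_j ~` H j) `&` [set z | S 0]).
  apply/seteqP; split => z /=.
    move/(first_hit_in [set u | D (z.1, u)] S z.2) => [[j [Dj jm Sj]]|[nD S0]].
      by left; exists j.
    by right; split => // j _; exact: nD.
  move=> h; apply/(first_hit_in [set u | D (z.1, u)] S z.2).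
  case: h => [[j _ [[Dj jm] Sj]]|[nD S0]].
    by left; exists j.
  by right; split => // j; exact: nD.
apply: measurableU.
  apply: bigcupT_measurable => j; apply: measurableI; last exact: mS'.
  apply: measurableI; first exact: mhit.
  by apply: fin_bigcap_measurable => // i _; exact: mnH.
apply: measurableI; first by apply: bigcapT_measurable => j; exact: mnH.
have [S0|S0] := pselect (S 0).
  by rewrite (_ : [set z | S 0] = setT)//; apply/seteqP; split.
by rewrite (_ : [set z | S 0] = set0)//; apply/seteqP; split.
Qed.

End first_hit_measurable.

Section first_hit_law.
Context (R : realType).
Implicit Types (S D E : set R).

Lemma measurable_first_hitR D : measurable D -> measurable_fun setT (first_hit D).
Proof.
move=> mD; have mD' : measurable [set z : R * R | D z.2].
  by apply: (@measurable_preim _ _ _ _ (@snd R R)) mD; exact: measurable_snd.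
have mp : measurable_fun setT (fun u : R => ((0 : R), u)).
  exact/measurable_fun_pair.
exact: measurableT_comp (measurable_first_hit mD') mp.
Qed.

Let m1 D : measurable D -> measurable (@even_bits R @^-1` D).
Proof. exact: measurable_preim (@measurable_even_bits R). Qed.

Let m2 D : measurable D -> measurable (@odd_bits R @^-1` D).
Proof. exact: measurable_preim (@measurable_odd_bits R). Qed.

(* Conditioning on the first coordinate, [t = pr (S `&` D) + (1 - pr D) * t] for
   the probability [t] that the first hit lies in [S]. *)
Lemma pr_first_hit D S : measurable D -> measurable S ->
  pr (unif R) D * pr (unif R) (first_hit D @^-1` S) = pr (unif R) (S `&` D).
Proof.
move=> mD mS; have mSD := measurableI _ _ mS mD.
have mh := measurable_preim (measurable_first_hitR mD) mS.
have E : first_hit D @^-1` S = (even_bits @^-1` (S `&` D) `&` odd_bits @^-1` setT) `|`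
    (even_bits @^-1` (~` D) `&` odd_bits @^-1` (first_hit D @^-1` S)).
  apply/seteqP; split => u /=; rewrite (first_hitE D u); case: asboolP; tauto.
have : pr (unif R) (first_hit D @^-1` S) =
    pr (unif R) (S `&` D) +
    (1 - pr (unif R) D) * pr (unif R) (first_hit D @^-1` S).
  rewrite {1}E prU.
  - rewrite !pr_even_bits_odd_bits//; last exact: measurableC.
    by rewrite prT mulr1 prC.
  - by apply: measurableI; [exact: m1|exact: m2].
  - by apply: measurableI; [apply: m1; exact: measurableC|exact: m2].
  - by apply/seteqP; split=> u //= [[[_ Du] _] []].
by move: (pr _ (first_hit D @^-1` S)) => t; lra.
Qed.

Lemma measurable_first_hit_neq D E : measurable D -> measurable E ->
  measurable [set u | first_hit D u <> first_hit E u].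
Proof.
move=> mD mE; rewrite [X in measurable X](_ : _ =
    (fun u => first_hit D u - first_hit E u) @^-1` (~` [set 0])).
  apply: measurable_preim; last exact: measurableC.
  by apply: measurable_funB; exact: measurable_first_hitR.
apply/seteqP; split => u /=.
  by move=> ne e; apply: ne; apply/eqP; rewrite -subr_eq0; apply/eqP.
by move=> ne e; apply: ne; rewrite e subrr.
Qed.

(** If the first dart lies in both sets, the hits agree; if it lies in neither, the search restarts.
    Hence the probability t of different hits is at most the mass of the symmetric difference plus
    [(1 - pr (D]|[E)) * t]. *)
Lemma pr_first_hit_neq D E : measurable D -> measurable E ->
  pr (unif R) (D `|` E) *
  pr (unif R) [set u | first_hit D u <> first_hit E u] <=
  pr (unif R) ((D `&` ~` E) `|` (E `&` ~` D)).
Proof.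
move=> mD mE.
have mN := measurable_first_hit_neq mD mE.
have mDE : measurable (D `|` E) by exact: measurableU.
have mS : measurable ((D `&` ~` E) `|` (E `&` ~` D)).
  by apply: measurableU; apply: measurableI => //; exact: measurableC.
set N := [set u | _] in mN *.
have sub : N `<=` (even_bits @^-1` ((D `&` ~` E) `|` (E `&` ~` D)) `&` odd_bits @^-1` setT)
   `|` (even_bits @^-1` (~` (D `|` E)) `&` odd_bits @^-1` N).
  move=> u; rewrite /N /=; rewrite (first_hitE D u) (first_hitE E u).
  by case: asboolP; case: asboolP; tauto.
have : pr (unif R) N <= pr (unif R) ((D `&` ~` E) `|` (E `&` ~` D)) +
    (1 - pr (unif R) (D `|` E)) * pr (unif R) N.
  rewrite -prC// -[X in X + _]mulr1 -(prT (unif R)) -!pr_even_bits_odd_bits//.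
  - apply: le_trans (prU_le _ _ _).
    + apply: pr_le => //; apply: measurableU; apply: measurableI;
        by [apply: m1; try exact: measurableC|exact: m2].
    + by apply: measurableI; [exact: m1|exact: m2].
    + by apply: measurableI; [apply: m1; exact: measurableC|exact: m2].
  - exact: measurableC.
by move: (pr _ N) => t; lra.
Qed.

End first_hit_law.

(** * Coupling maps *)

Lemma measurable_neq_fin d (T : measurableType d) (A : finType) (f g : T -> A) :
  (forall a, measurable (f @^-1` [set a])) ->
  (forall a, measurable (g @^-1` [set a])) -> measurable [set x | f x <> g x].
Proof.
move=> mf mg; rewrite (_ : [set x | f x <> g x] =
    \bigcup_(a in [set: A]) (f @^-1` [set a] `&` ~` (g @^-1` [set a]))).
  apply: fin_bigcup_measurable => // a _; apply: measurableI => //.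
  exact: measurableC.
apply/seteqP; split => x /=; first by move=> ne; exists (f x) => //; split => // /esym.
by move=> [a _ [-> ne]] /esym.
Qed.

Section coupling_maps.
Context (R : realType) d (Y : measurableType d) (A : finType) (p : Y -> A -> R).
Hypothesis p_ge0 : forall x a, 0 <= p x a.
Hypothesis p_sum1 : forall x, \sum_(a : A) p x a = 1.
Hypothesis p_meas : forall a, measurable_fun setT (p ^~ a).

Definition coupling_map (c : R) (f : Y -> R -> A) :=
  [/\ forall a, measurable [set z : Y * R | f z.1 z.2 = a],
      forall x a, pr (unif R) [set u | f x u = a] = p x a &
      forall x y, pr (unif R) [set u | f x u <> f y u] <= c * tv (p x) (p y)].

Lemma p_le1 x a : p x a <= 1.
Proof. by rewrite -(p_sum1 x) (bigD1 a)//= lerDl sumr_ge0. Qed.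

Lemma clamp_id (x : R) : 0 <= x <= 1 -> clamp x = x.
Proof. by move=> x01; rewrite /clamp; repeat (case: ifPn; rewrite -?ltNge => * ); lra. Qed.

Lemma pr_unif_itv (x y : R) : 0 <= x -> x <= y -> y <= 1 ->
  pr (unif R) `]x, y]%classic = y - x.
Proof.
move=> x0 xy y1.
have := pr_split (unif R) (measurable_itv `]-oo, y]) (measurable_itv `]-oo, x]).
have -> : `]-oo, y] `&` `]-oo, x] = `]-oo, x]%classic.
  apply/seteqP; split => u /=; rewrite !in_itv/=; first by case.
  by move=> ux; split; lra.
have -> : `]-oo, y] `&` ~` `]-oo, x] = `]x, y]%classic.
  apply/seteqP; split => u /=; rewrite !in_itv/=.
    by move=> [-> /negP]; rewrite -ltNge => ->.
  by move=> /andP[xu ->]; split => //; apply/negP; rewrite -ltNge.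
by rewrite !unif_cdf !clamp_id; lra.
Qed.

(** Two pasts disagree exactly when [u] falls between their thresholds. With two letters both
    differences of probabilities have the same modulus, so the length of this interval is the total
    variation distance. *)
Lemma exists_coupling_map2 : #|A| = 2%N -> exists f, coupling_map 1 f.
Proof.
move=> A2.
have /cards2P[a1 [a2 [a12 eA]]] : #|[set: A]%SET| == 2%N by rewrite cardsT A2.
clear A2.
have Acase a : a = a1 \/ a = a2.
  have : a \in [set: A]%SET by rewrite inE.
  by rewrite eA !inE => /orP[/eqP->|/eqP->]; [left|right].
clear eA.
have psum x : p x a1 + p x a2 = 1.
  rewrite -(p_sum1 x) (bigD1 a1)//= (bigD1 a2)//= ?big1 ?addr0//; last by rewrite eq_sym.
  by move=> a /andP[]; case: (Acase a) => ->; rewrite eqxx.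
pose f x u := if u <= p x a1 then a1 else a2.
have f1 x : [set u | f x u = a1] = `]-oo, p x a1]%classic.
  apply/seteqP; split => u /=; rewrite /f in_itv/=; case: (u <= _) => //= e.
  by move: a12; rewrite e eqxx.
have ne12 : a1 <> a2 by apply/eqP.
have f2 x : [set u | f x u = a2] = ~` `]-oo, p x a1]%classic.
  rewrite -f1; apply/seteqP; split => u /=; rewrite /f; case: ifP => // _.
  by move=> _ /esym.
have pr1 x : pr (unif R) `]-oo, p x a1]%classic = p x a1.
  by rewrite unif_cdf clamp_id// p_ge0 p_le1.
exists f; split.
- have m1 : measurable [set z : Y * R | f z.1 z.2 = a1].
    rewrite [X in measurable X](_ : _ = [set z : Y * R | z.2 <= p z.1 a1]).
      rewrite -[X in measurable X]setTI; apply: measurable_fun_ler => //.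
      exact: measurableT_comp (p_meas a1) measurable_fst.
    apply/seteqP; split => z /=; rewrite /f; case: (z.2 <= _) => //= e.
    by move: a12; rewrite e eqxx.
  move=> a; case: (Acase a) => -> //.
  rewrite [X in measurable X](_ : _ = ~` [set z : Y * R | f z.1 z.2 = a1]).
    exact: measurableC.
  by apply/seteqP; split => z /=; rewrite /f; case: ifP => // _ _ /esym.
- move=> x a; case: (Acase a) => ->; first by rewrite f1.
  by rewrite f2 prC// pr1 -(psum x) addrAC subrr add0r.
- move=> x y.
  have -> : 1 * tv (p x) (p y) = `|p x a1 - p y a1|.
    rewrite mul1r /tv (bigD1 a1)//= (bigD1 a2)//= ?big1 ?addr0//; last by rewrite eq_sym.
      have -> : p x a2 - p y a2 = - (p x a1 - p y a1).
        by have := psum x; have := psum y; lra.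
      by rewrite normrN; lra.
    by move=> a /andP[]; case: (Acase a) => ->; rewrite eqxx.
  wlog le : x y / p x a1 <= p y a1.
    move=> wl; have [/wl//|/ltW/wl] := leP (p x a1) (p y a1).
    rewrite distrC; apply: le_trans; rewrite le_eqVlt; apply/orP; left; apply/eqP.
    by congr pr; apply/seteqP; split => u /=; apply: contra_not => ->.
  have -> : [set u | f x u <> f y u] = `]p x a1, p y a1]%classic.
    apply/seteqP; split => u /=; rewrite /f in_itv/= !(leNgt u).
      case: ltP => xu /=; case: ltP => yu //=.
      by have := le_lt_trans (le_trans xu le) yu; rewrite ltxx.
    by move=> /andP[-> ->] /= /esym.
  rewrite pr_unif_itv ?p_le1//; rewrite ler0_norm; lra.
Qed.

(* Rejection sampling with a common sequence of uniform darts: letter [a] of rank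
   [r] owns the box ](r/k), (r+1)/k], of which the past [x] accepts the first
   fraction [p x a].  The first darts accepted by [x] and by [y] differ only if the
   first dart accepted by one of them is rejected by the other. *)
Lemma exists_coupling_map (a0 : A) : exists f, coupling_map 2 f.
Proof.
pose k : R := #|A|%:R.
have k_gt0 : 0 < k by rewrite ltr0n; apply/card_gt0P; exists a0.
pose r (a : A) : R := (enum_rank a)%:R.
have r_ge0 a : 0 <= r a by [].
have r_lt a : r a + 1 <= k.
  by rewrite /r /k natr1 ler_nat; exact: (ltn_ord (enum_rank a)).
have r_inj a b u : r a < u -> u <= r a + 1 -> r b < u -> u <= r b + 1 -> a = b.
  move=> h1 h2 h3 h4.
  have : r a < r b + 1 by lra.
  have : r b < r a + 1 by lra.
  rewrite /r !natr1 !ltr_nat !ltnS => h5 h6.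
  by apply: enum_rank_inj; apply/val_inj/eqP; rewrite /= eqn_leq h5 h6.
pose dart x a := [set u : R | r a < k * u <= r a + p x a].
pose box a := [set u : R | r a < k * u <= r a + 1].
have dart_box x a : dart x a `<=` box a.
  by move=> u; rewrite /dart /box /=; have := p_le1 x a; lra.
have box_inj a b u : box a u -> box b u -> a = b.
  by move=> /andP[h1 h2] /andP[h3 h4]; exact: r_inj h1 h2 h3 h4.
(* [a0] is a junk letter for points outside all boxes. *)
pose label u := if [pick a | r a < k * u <= r a + 1] is Some a then a else a0.
have labelE a u : box a u -> label u = a.
  rewrite /label => bu; case: pickP => [b bb|/(_ a)]; first exact: (box_inj b a u).
  by rewrite /box /= in bu; rewrite bu.
pose D x := [set u : R | exists a, dart x a u].
have D_label x a : D x `&` [set u | label u = a] = dart x a.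
  apply/seteqP; split => u /=; last first.
    by move=> du; split; [exists a|apply: labelE; exact: dart_box du].
  by move=> [[b db] <-]; rewrite (labelE b)//; exact: dart_box db.
have itvE (x y : R) : [set u : R | x < k * u <= y] = `](x / k), (y / k)]%classic.
  by apply/seteqP; split => u /=; rewrite in_itv/= ltr_pdivrMr// ler_pdivlMr// mulrC.
have mitv (x y : R) : measurable [set u : R | x < k * u <= y] by rewrite itvE.
have pitv (x y : R) : 0 <= x -> x <= y -> y <= k ->
    pr (unif R) [set u : R | x < k * u <= y] = (y - x) / k.
  move=> x0 xy yk; rewrite itvE pr_unif_itv ?mulrBl//.
  - by apply: divr_ge0 => //; lra.
  - by rewrite ler_pM2r ?invr_gt0.
  - by rewrite ler_pdivrMr ?mul1r.
have mlabel a : measurable [set u | label u = a].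
  have -> : [set u | label u = a] =
      box a `|` ([set u | a = a0] `&` ~` \bigcup_(b in [set: A]) box b).
    apply/seteqP; split => u /=.
      rewrite /label; case: pickP => [b bb <-|nb <-]; first by left.
      by right; split => // -[b _ bu]; have := nb b; rewrite bu.
    move=> [/labelE//|[-> nb]]; rewrite /label; case: pickP => // b bb.
    by exfalso; apply: nb; exists b.
  apply: measurableU; first exact: mitv.
  apply: measurableI.
    have [->|ne] := pselect (a = a0).
      by rewrite (_ : [set u | _] = setT)//; apply/seteqP; split.
    by rewrite (_ : [set u | _] = set0)//; apply/seteqP; split.
  by apply: measurableC; apply: fin_bigcup_measurable => // b _; exact: mitv.
have mD x : measurable (D x).
  rewrite (_ : D x = \bigcup_(a in [set: A]) dart x a); last first.
    by apply/seteqP; split => u [a]; [exists a|move=> _; exists a].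
  by apply: fin_bigcup_measurable => // a _; exact: mitv.
have split_label E : measurable E ->
    pr (unif R) E = \sum_a pr (unif R) (E `&` [set u | label u = a]).
  move=> mE; apply: pr_fin_split => //; first by move=> a b u /= -> ->.
  by move=> u; exists (label u).
have pdart x a : pr (unif R) (dart x a) = p x a / k.
  rewrite /dart pitv ?lerDl//; first by rewrite addrAC subrr add0r.
  by have := r_lt a; have := p_le1 x a; lra.
(* Every past accepts with the same probability, so conditioning on acceptance turns the masses
   [p x a / k] back into [p x a]. *)
have prD x : pr (unif R) (D x) = k^-1.
  rewrite split_label//; under eq_bigr => a _ do rewrite D_label pdart.
  by rewrite -mulr_suml p_sum1 mul1r.
exists (fun x u => label (first_hit (D x) u)); split.
- move=> a.
  have mDD : measurable [set z : Y * R | D z.1 z.2].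
    rewrite (_ : [set z | _] = \bigcup_(a in [set: A])
      ([set z : Y * R | r a < k * z.2] `&` [set z : Y * R | k * z.2 <= r a + p z.1 a])).
      apply: fin_bigcup_measurable => // b _; apply: measurableI.
        rewrite -[X in measurable X]setTI; apply: measurable_fun_ltr => //.
        exact: measurable_funM.
      rewrite -[X in measurable X]setTI; apply: measurable_fun_ler => //.
        exact: measurable_funM.
      apply: measurable_funD => //.
      exact: measurableT_comp (p_meas b) measurable_fst.
    apply/seteqP; split => z.
      by move=> [b /andP[h1 h2]]; exists b.
    by move=> [b _ [h1 h2]]; exists b; apply/andP.
  exact: (measurable_preim (measurable_first_hit mDD) (mlabel a)).
- move=> x a.
  have := pr_first_hit (mD x) (mlabel a).
  rewrite setIC D_label pdart prD mulrC => /mulIf; apply.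
  by rewrite invr_neq0// gt_eqF.
- move=> x y.
  have mS : measurable ((D x `&` ~` D y) `|` (D y `&` ~` D x)).
    by apply: measurableU; apply: measurableI => //; exact: measurableC.
  (* In the box of [a] both acceptance intervals start at the same point, so they differ by a mass
     [|p x a - p y a| / k]. The sum of these is twice the total variation, whence the constant 2. *)
  have sym : pr (unif R) ((D x `&` ~` D y) `|` (D y `&` ~` D x)) =
      2 * tv (p x) (p y) / k.
    rewrite split_label// /tv mulrA mulfV// mul1r mulr_suml.
    apply: eq_bigr => a _.
    have -> : ((D x `&` ~` D y) `|` (D y `&` ~` D x)) `&` [set u | label u = a] =
        (dart x a `&` ~` dart y a) `|` (dart y a `&` ~` dart x a).
      by rewrite -!D_label; apply/seteqP; split => u /=; tauto.
    clear mS; wlog le : x y / p x a <= p y a.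
      move=> wl; have [/wl//|/ltW/wl] := leP (p x a) (p y a).
      by rewrite distrC setUC.
    have -> : (dart x a `&` ~` dart y a) `|` (dart y a `&` ~` dart x a) =
        [set u | r a + p x a < k * u <= r a + p y a].
      apply/seteqP; split => u /=; rewrite /dart /=.
        move=> [[h /negP]|[h /negP]]; first by rewrite negb_and -ltNge; lra.
        rewrite negb_and -leNgt -ltNge; have := p_ge0 x a; lra.
      move=> h; right; have := p_ge0 x a; split; first lra.
      by apply/negP; rewrite negb_and -ltNge; lra.
    rewrite pitv.
    + by rewrite ler0_norm; lra.
    + by have := p_ge0 x a; have := r_ge0 a; lra.
    + lra.
    + by have := r_lt a; have := p_le1 y a; lra.
  have mDxy : measurable (D x `|` D y) by exact: measurableU.
  have mh z : measurable_fun setT (first_hit (D z)) by exact: measurable_first_hitR.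
  have mN := measurable_first_hit_neq (mD x) (mD y).
  (* This lower bound cancels the factor [k^-1] of [sym]. *)
  have k1 : k^-1 <= pr (unif R) (D x `|` D y).
    by rewrite -(prD x); apply: pr_le => // u; left.
  have := pr_first_hit_neq (mD x) (mD y); rewrite sym.
  have ki : 0 < k^-1 by rewrite invr_gt0.
  set N := [set u | first_hit _ u <> _] in mN *.
  have le : pr (unif R) [set u | label (first_hit (D x) u) <> label (first_hit (D y) u)]
      <= pr (unif R) N.
    apply: pr_le => //; last by move=> u; apply: contra_not => ->.
    by apply: measurable_neq_fin => a; exact: measurable_preim (mh _) (mlabel a).
  have := pr_ge0 (unif R) N.
  move: le; set t := tv _ _; move: (pr _ [set u | label _ <> _]) (pr _ N).
  move=> q n qn n0 h; apply: le_trans qn _.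
  rewrite -(@ler_pM2r _ k^-1)//; apply: le_trans h.
  by rewrite mulrC ler_wpM2r.
Qed.

End coupling_maps.

(** * The house-of-cards chain *)

Section renewal.
Context (R : realType) (eta : nat -> R).
Hypothesis eta_itv : forall n, 0 <= eta n <= 1.
Hypothesis eta_noninc : forall n, eta n.+1 <= eta n.
Implicit Types (g : nat -> R) (j k l : nat).

(* Transition operator of the chain jumping from [l] to [l.+1] with probability
   [1 - eta l] and to [0] otherwise; [match_reset j] is the probability that the
   chain started at [0] is at [0] at time [j]. *)
Definition match_step g l : R := (1 - eta l) * g l.+1 + eta l * g 0%N.

Definition match_reset j : R := iter j match_step (fun l => (l == 0%N)%:R) 0%N.

Definition match_run k : R := \prod_(n < k) (1 - eta n).

(** Stochastic monotonicity: from a higher state the chain resets less often and otherwise lands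
    higher, while [g] is largest at 0. *)
Lemma match_stepP g : (forall l, g l.+1 <= g l) ->
  forall l, match_step g l.+1 <= match_step g l.
Proof.
move=> gd l; have g0 : forall k, g k <= g 0%N.
  by elim=> // k IH; exact: le_trans (gd k) IH.
rewrite /match_step; have := gd l.+1; have := g0 l.+1; have := g0 l.+2.
have := eta_noninc l; have := eta_itv l; have := eta_itv l.+1; nra.
Qed.

Lemma iter_match_stepP j g : (forall l, g l.+1 <= g l) ->
  forall l, iter j match_step g l.+1 <= iter j match_step g l.
Proof. by move=> gd; elim: j => [//|j IH] l; rewrite !iterS; exact: match_stepP. Qed.

(** After its first step the chain is at 0 or 1. By monotonicity, being at 0 after [j] further steps
    is no likelier from 1 than from 0. *)
Lemma match_reset_noninc j : match_reset j.+1 <= match_reset j.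
Proof.
rewrite /match_reset iterS {1}/match_step.
set h := iter _ _ _; have : h 1%N <= h 0%N.
  by apply: iter_match_stepP => -[|l] /=; rewrite ?lexx ?ler01.
by have := eta_itv 0; nra.
Qed.

(* Renewal decomposition according to the last visit to [0]. *)
Lemma iter_match_stepE j g : iter j match_step g 0%N =
  \sum_(k < j.+1) match_reset (j - k) * match_run k * g k.
Proof.
elim: j g => [|j IH] g.
  by rewrite big_ord1 /= /match_reset /match_run /= big_ord0 !mul1r.
have E f : iter j.+1 match_step f 0%N =
    \sum_(k < j.+1) match_reset (j - k) * match_run k.+1 * f k.+1 +
    (\sum_(k < j.+1) match_reset (j - k) * match_run k * eta k) * f 0%N.
  rewrite iterSr IH mulr_suml -big_split /=; apply: eq_bigr => k _.
  by rewrite /match_step /match_run big_ord_recr /=; ring.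
(* The coefficient of [f 0] in [E] does not depend on [f]; the indicator of 0 identifies it. *)
have R0 : match_reset j.+1 = \sum_(k < j.+1) match_reset (j - k) * match_run k * eta k.
  rewrite {1}/match_reset E /= mulr1 big1 ?add0r// => k _; exact: mulr0.
rewrite E -R0 [RHS]big_ord_recl /= addrC; congr (_ + _).
  by rewrite subn0 /match_run big_ord0 mulr1.
Qed.

(** The decomposition is applied to the constant function 1, and each [match_reset (j - k)] is
    bounded below by [match_reset j]. *)
Lemma match_reset_sum j : match_reset j * \sum_(k < j.+1) match_run k <= 1.
Proof.
have run0 k : 0 <= match_run k.
  by apply: prodr_ge0 => n _; have := eta_itv n; lra.
have const1 : iter j match_step (fun=> 1) 0%N = 1.
  suff : iter j match_step (fun=> 1) =1 (fun=> 1) by apply.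
  elim: j => [//|j IH] l; rewrite iterS /match_step !IH; lra.
rewrite -const1 iter_match_stepE mulr_sumr; apply: ler_sum => k _.
rewrite mulr1 ler_wpM2r//.
have nd i m : match_reset (m + i)%N <= match_reset m.
  elim: i => [|i IH]; first by rewrite addn0.
  by rewrite addnS; exact: le_trans (match_reset_noninc _) IH.
have := nd k (j - k)%N; rewrite subnK// -ltnS; exact: ltn_ord.
Qed.

Lemma match_reset_small :
  (fun K : nat => \sum_(k < K.+1) \prod_(n < k.+1) (1 - eta n)) @ \oo --> +oo ->
  forall e : R, 0 < e -> exists j, match_reset j <= e.
Proof.
move=> /cvgryPge H e e0.
have [K _ /(_ K (leqnn K)) HK] := H e^-1.
exists K.+1; have [r0|/ltW r0] := leP (match_reset K.+1) 0.
  by apply: le_trans r0 (ltW e0).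
rewrite -[leRHS]mul1r -ler_pdivrMr//.
apply: le_trans (match_reset_sum K.+1); rewrite ler_wpM2l//.
(* At time [K.+1] the renewal sum exceeds the partial sum of the hypothesis by the empty product
   1. *)
rewrite big_ord_recl {1}/match_run big_ord0; apply: le_trans HK _.
by rewrite lerDr.
Qed.

(** The agreement length need not be a Markov chain: only the mass [miss] sent back to 0 is
    controlled, and only from above. Testing against all nonincreasing [g] lets the comparison go
    through by induction on time. *)
Lemma match_reset_bound (law miss : nat -> nat -> R) :
  law 0%N 0%N = 1 ->
  (forall j l, 0 <= law j l) ->
  (forall j l, miss j l <= eta l * law j l) ->
  (forall j l, law j.+1 l.+1 = law j l - miss j l) ->
  (forall j, law j.+1 0%N = \sum_(l < j.+1) miss j l) ->
  forall j, law j 0%N <= match_reset j.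
Proof.
move=> law00 law_ge0 missP lawS law0 j.
suff : forall g, (forall l, g l.+1 <= g l) ->
    \sum_(l < j.+1) law j l * g l <= iter j match_step g 0%N.
  move/(_ (fun l => (l == 0%N)%:R)); rewrite -/(match_reset j).
  rewrite big_ord_recl /= mulr1 big1 ?addr0; last by move=> i _; exact: mulr0.
  by apply; case=> [|l] /=; rewrite ?lexx ?ler01.
elim: j => [|j IH] g gd; first by rewrite big_ord1 law00 mul1r.
have gd0 : forall k, g k <= g 0%N.
  by elim=> // k IHk; exact: le_trans (gd k) IHk.
rewrite iterSr; apply: le_trans (IH _ (match_stepP gd)).
rewrite big_ord_recl /= law0 mulr_suml -big_split /=; apply: ler_sum => l _.
rewrite lawS /match_step; have := missP j l; have := gd0 l.+1.
nra.
Qed.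

End renewal.

(** * Conditional independence *)

Section conditional_expectation.
Context d (T : measurableType d) (R : realType) (P : probability T R).
Variable G : set (set T).
Hypothesis Gm : <<s G >> `<=` measurable.
Implicit Types (f g h : T -> R) (B : set T).

Local Notation TG := (g_sigma_algebraType G).

Lemma sub_sigma_measurable_fun d' (T' : measurableType d') (f : T -> T') :
  measurable_fun [set: TG] (f : TG -> T') -> measurable_fun setT f.
Proof. by move=> mf _ S mS; apply: Gm; exact: mf. Qed.

(** The set where [g < h] belongs to the sigma-field, so the positive function [h - g] has integral
    0 over it and the set is null. *)
Lemma sub_sigma_le_ae g h :
  measurable_fun [set: TG] (g : TG -> R) -> measurable_fun [set: TG] (h : TG -> R) ->
  P.-integrable setT (EFin \o g) -> P.-integrable setT (EFin \o h) ->
  (forall B, <<s G >> B -> (\int[P]_(w in B) (g w)%:E = \int[P]_(w in B) (h w)%:E)%E) ->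
  {ae P, forall w, h w <= g w}.
Proof.
move=> mg mh ig ih gh.
pose B := [set w : T | g w < h w].
have GB : <<s G >> B.
  rewrite -[X in <<s G >> X]setTI.
  by apply: (@measurable_fun_ltr _ TG R setT g h).
have mB := Gm GB.
have mgB : measurable_fun B g by apply: measurable_funTS; exact: sub_sigma_measurable_fun.
have mhB : measurable_fun B h by apply: measurable_funTS; exact: sub_sigma_measurable_fun.
have int0 : (\int[P]_(w in B) `|(h w - g w)%:E| = 0)%E.
  rewrite (eq_integral (fun w => ((EFin \o h) \- (EFin \o g)) w)%E); last first.
    by move=> w; rewrite inE /B /= => gw; rewrite ger0_norm ?EFinB// subr_ge0 ltW.
  have igB : P.-integrable B (EFin \o g) by exact: (integrableS measurableT mB _ ig).
  have ihB : P.-integrable B (EFin \o h) by exact: (integrableS measurableT mB _ ih).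
  rewrite integralB// -[X in (X - _)%E]gh// subee//.
  exact: (integrable_fin_num mB igB).
have mhg : measurable_fun B (fun w => (h w - g w)%:E).
  by apply/measurable_EFinP; exact: measurable_funB.
have := (ae_eq_integral_abs P mB mhg).1 int0; apply: filterS => w /= Bw.
rewrite leNgt; apply/negP => gw; have := Bw gw.
by case=> /eqP; rewrite subr_eq0 => /eqP e; move: gw; rewrite e ltxx.
Qed.

Lemma sub_sigma_eq_ae g h :
  measurable_fun [set: TG] (g : TG -> R) -> measurable_fun [set: TG] (h : TG -> R) ->
  P.-integrable setT (EFin \o g) -> P.-integrable setT (EFin \o h) ->
  (forall B, <<s G >> B -> (\int[P]_(w in B) (g w)%:E = \int[P]_(w in B) (h w)%:E)%E) ->
  {ae P, forall w, g w = h w}.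
Proof.
move=> mg mh ig ih gh.
have le1 := sub_sigma_le_ae mg mh ig ih gh.
have le2 : {ae P, forall w, g w <= h w}.
  by apply: (sub_sigma_le_ae mh mg ih ig) => B GB; rewrite gh.
by apply: filterS2 le1 le2 => w h1 h2; apply/eqP; rewrite eq_le h1 h2.
Qed.

(* [E2] has the same conditional law given [G] and [E1] as a section of the
   [G]-measurable family [H] at an independent random parameter. *)
Lemma cond_indep_sections d' (T' : measurableType d') (Q : probability T' R)
    (H : set (T * T')) (E1 E2 : set T) (g1 g2 g12 : T -> R) :
  measurable (H : set (TG * T')) -> measurable E1 -> measurable E2 ->
  (forall B, <<s G >> B ->
     P (B `&` E2) = (\int[Q]_v P (B `&` [set w | H (w, v)]))%E /\
     P (B `&` E1 `&` E2) = (\int[Q]_v P (B `&` E1 `&` [set w | H (w, v)]))%E) ->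
  is_cond_exp P <<s G >> (\1_E1) g1 -> is_cond_exp P <<s G >> (\1_E2) g2 ->
  is_cond_exp P <<s G >> (\1_(E1 `&` E2)) g12 ->
  {ae P, forall w, g12 w = g1 w * g2 w}.
Proof.
move=> mHG mE1 mE2 PE [mg1 [ig1 g1E]] [mg2 [ig2 g2E]] [mg12 [ig12 g12E]].
have mgG g : (forall S : set R, measurable S -> <<s G >> (g @^-1` S)) ->
  measurable_fun [set: TG] (g : TG -> R) by move=> mg _ S mS; rewrite setTI; exact: mg.
have mH : measurable H.
  have mi : measurable_fun [set: T * T'] ((fun z => (z.1, z.2)) : T * T' -> TG * T').
    apply: measurable_fun_pair => //.
    move=> _ B GB; rewrite setTI; exact: (measurable_preim measurable_fst (Gm GB)).
  have := mi measurableT _ mHG; rewrite setTI.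
  by congr (measurable _); apply/seteqP; split => -[].
have mHw w : measurable [set v | H (w, v)].
  by have := measurable_xsection w mH; congr measurable; rewrite xsectionE.
have mHv v : <<s G >> [set w | H (w, v)].
  by have := @measurable_ysection _ _ TG T' H v mHG; rewrite ysectionE.
(* The common conditional probability of [E2], given the sigma-field alone or given [E1] as well. *)
pose phi w : R := pr Q [set v | H (w, v)].
have phiE w : (phi w)%:E = Q (xsection H w) by rewrite -prE// xsectionE.
have phi01 w : 0 <= phi w <= 1 by rewrite pr_ge0 pr_le1.
have mphi : measurable_fun [set: TG] (phi : TG -> R).
  apply/measurable_EFinP.
  rewrite (_ : EFin \o _ = Q \o @xsection TG T' H); last first.
    by apply/funext => w; exact: phiE.
  exact: measurable_fun_xsection.
have mphiT := sub_sigma_measurable_fun mphi.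
have bphi : [bounded phi w | w in [set: T]].
  exists 1; split => // M M1 w _ /=; rewrite ger0_norm; first by have := phi01 w; lra.
  by have := phi01 w; lra.
have iphi : P.-integrable setT (EFin \o phi).
  apply: measurable_bounded_integrable => //.
  by apply: le_lt_trans (probability_le1 P measurableT) _; rewrite ltry.
have ig1phi : P.-integrable setT (EFin \o (fun w => g1 w * phi w)).
  have -> : EFin \o (fun w => g1 w * phi w) = ((EFin \o g1) \* (EFin \o phi))%E.
    by apply/funext => w /=; rewrite EFinM.
  exact: integrableMl.
have g2phi : {ae P, forall w, g2 w = phi w}.
  apply: sub_sigma_eq_ae => //; first exact: mgG.
  move=> B GB; have mB := Gm GB.
  have mBH : measurable ((B `*` setT) `&` H) by apply: measurableI => //; exact: measurableX.
  have := indic_fubini_tonelli P Q mBH.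
  rewrite indic_fubini_tonelli_FE// indic_fubini_tonelli_GE// => fub.
  rewrite g2E// integral_indic// (setIC E2 B); apply: etrans (PE B GB).1 _.
  transitivity (\int[Q]_v (P \o ysection ((B `*` setT) `&` H)) v)%E.
    apply: eq_integral => v _ /=; congr (P _); rewrite ysectionE.
    by apply/seteqP; split => w /= [Bw Hw]; split => //; case: Bw.
  rewrite -fub [RHS]integral_mkcond; apply: eq_integral => w _ /=.
  rewrite patchE; case: ifPn => [|]; rewrite ?inE ?notin_setE => Bw.
    rewrite phiE; congr (Q _); rewrite !xsectionE.
    by apply/seteqP; split => v /=; [case|].
  rewrite [X in Q X](_ : _ = set0) ?measure0// xsectionE.
  by apply/seteqP; split => v //= [[]].
have g12phi : {ae P, forall w, g12 w = g1 w * phi w}.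
  apply: sub_sigma_eq_ae => //; first exact: mgG.
    by apply: measurable_funM => //; exact: mgG.
  move=> B GB; have mB := Gm GB.
  rewrite g12E// integral_indic//; last exact: measurableI.
  rewrite (setIC _ B) setIA; apply: etrans (PE B GB).2 _.
  pose F (z : T * T') : \bar R := (g1 z.1 * \1_(B `*` setT) z * \1_H z)%:E.
  have mF : measurable_fun setT F.
    apply/measurable_EFinP; apply: measurable_funM; last exact: measurable_indic.
    apply: measurable_funM; last by apply: measurable_indic; exact: measurableX.
    by apply: measurableT_comp measurable_fst; apply: sub_sigma_measurable_fun; exact: mgG.
  have FE w v : F (w, v) = (g1 w * \1_B w * \1_[set v | H (w, v)] v)%:E.
    rewrite /F /= !indicE.
    have -> : ((w, v) \in B `*` setT) = (w \in B).
      by apply/idP/idP; rewrite !inE /=; [case|].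
    by have -> : ((w, v) \in H) = (v \in [set v | H (w, v)]) by apply/idP/idP; rewrite !inE.
  have intF w : (\int[Q]_v F (w, v) = (g1 w * \1_B w)%:E * (phi w)%:E)%E.
    under eq_integral do rewrite FE EFinM.
    rewrite integralZl//; last exact: integrable_indic.
    by rewrite integral_indic// setIT phiE xsectionE.
  have iF : (P \x Q)%E.-integrable setT F.
    apply/integrable12ltyP => //.
    apply: (@le_lt_trans _ _ (\int[P]_w `|(g1 w)%:E|)%E); last by case/integrableP: ig1.
    apply: ge0_le_integral => //.
    - by move=> w _; apply: integral_ge0.
    - apply: (@measurable_fun_fubini_tonelli_F _ _ _ _ _ Q (abse \o F)); last by move=> z; exact: abse_ge0.
      exact: measurableT_comp.
    - by apply: (@measurableT_comp _ _ _ _ _ _ abse _ (EFin \o g1)) => //; case/integrableP: ig1.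
    - move=> w _; apply: (@le_trans _ _ (\int[Q]_v `|(g1 w)%:E|)%E).
        apply: ge0_le_integral => //.
        + apply: measurableT_comp => //.
          exact: (measurable_fun_pair2 w mF).
        + move=> v _; rewrite FE lee_fin !normrM -[leRHS]mulr1 -mulrA.
          rewrite ler_wpM2l// -[leRHS]mulr1 ler_pM// indicE.
            by case: (_ \in _); rewrite ?normr1 ?normr0 ?ler01.
          by case: (_ \in _); rewrite ?normr1 ?normr0 ?ler01.
      rewrite integral_cst// [X in (_ * X)%E](_ : _ = 1%E) ?mule1//.
      exact: probability_setT.
  have := Fubini iF; under eq_integral do rewrite intF.
  move=> fub; rewrite [RHS]integral_mkcond.
  transitivity (\int[P]_w ((g1 w * \1_B w)%:E * (phi w)%:E))%E; last first.
    apply: eq_integral => w _; rewrite patchE indicE.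
    by case: (w \in B); rewrite /= ?mulr1 ?mulr0 ?mul0e// EFinM.
  rewrite {}fub; apply: eq_integral => v _.
  (* With the parameter frozen, the section of [H] belongs to the sigma-field, so the defining
     property of [g1] applies to it. *)
  have GBv : <<s G >> (B `&` [set w | H (w, v)]) by exact: (@measurableI _ TG _ _ GB (mHv v)).
  have := g1E _ GBv; rewrite integral_indic//; last exact: Gm.
  rewrite (_ : B `&` E1 `&` _ = E1 `&` (B `&` [set w | H (w, v)])); last first.
    by apply/seteqP; split => w /=; tauto.
  move=> <-; rewrite integral_mkcond; apply: eq_integral => w _.
  rewrite FE patchE !indicE; case: ifPn; rewrite ?inE ?notin_setE /=.
    by move=> [Bw Hw]; rewrite !mem_set// !mulr1.
  move=> nBH; have [Bw|Bw] := pselect (B w); last by rewrite (memNset Bw) mulr0 mul0r.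
  by rewrite (memNset (_ : ~ [set v | H (w, v)] v)) ?mulr0//= => Hw; apply: nBH.
by apply: filterS2 g2phi g12phi => w -> ->.
Qed.

End conditional_expectation.

(** * Processes driven by an independent noise *)

(* An alias of [nat -> A] carrying the point needed by measurable types. *)
Definition pasts (A : finType) (a0 : A) : Type := nat -> A.

HB.instance Definition _ (A : finType) (a0 : A) := gen_eqMixin (pasts a0).
HB.instance Definition _ (A : finType) (a0 : A) := gen_choiceMixin (pasts a0).
HB.instance Definition _ (A : finType) (a0 : A) :=
  isPointed.Build (pasts a0) (fun=> a0).

(** These are the generators of [cyl_sigma], so measurability in [past_space] is the one used in
    [regular_cond_law]. *)
Definition past_cylinders (A : Type) : set (set (nat -> A)) :=
  [set C | exists (k : nat) (a : A), C = [set x | x k = a]].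

Arguments past_cylinders A : clear implicits.

Notation past_space a0 := (g_sigma_algebraType (past_cylinders _ : set (set (pasts a0)))).

Section pasts.
Context (A : finType) (a0 : A).

Lemma measurable_pastP d (T : measurableType d) (g : T -> nat -> A) :
  (forall k a, measurable [set z | g z k = a]) ->
  measurable_fun setT (g : T -> past_space a0).
Proof.
move=> mg; apply: (@measurability _ _ _ _ _ _ (past_cylinders A : set (set (past_space a0)))) => //.
by move=> _ [_ [k [a ->]] <-]; rewrite setTI; exact: mg.
Qed.

Lemma measurable_past_coord k a : measurable [set x : past_space a0 | x k = a].
Proof. by apply: sub_sigma_algebra; exists k, a. Qed.

Definition past_cons (a : A) (x : nat -> A) : nat -> A :=
  fun k => if k is i.+1 then x i else a.

Definition past_tail (x : nat -> A) : nat -> A := fun k => x k.+1.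

Lemma past_of_cons (T : Type) (X : int -> T -> A) n z :
  past_of X n z = past_cons (X n z) (past_of X (n - 1) z).
Proof.
apply/funext => -[|k]; rewrite /past_of /= ?subr0//.
by congr X; lia.
Qed.

Lemma past_of_tail (T : Type) (X : int -> T -> A) n z :
  past_tail (past_of X n z) = past_of X (n - 1) z.
Proof. by rewrite past_of_cons. Qed.

Lemma measurable_past_tail :
  measurable_fun setT (past_tail : past_space a0 -> past_space a0).
Proof. by apply: measurable_pastP => k a; exact: measurable_past_coord. Qed.

Lemma measurable_past_of d (T : measurableType d) (X : int -> T -> A) n :
  (forall k a, k <= n -> measurable [set z | X k z = a]) ->
  measurable_fun setT (past_of X n : T -> past_space a0).
Proof. by move=> mX; apply: measurable_pastP => k a; apply: mX; lia. Qed.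

End pasts.

Arguments past_tail {A} x.
Arguments past_cons {A} a x.

Section driven_process.
Context (A : finType) (a0 : A) d (T : measurableType d) (R : realType).
Variables (P : probability T R) (X : int -> T -> A) (U : int -> T -> R).
Variable f : (nat -> A) -> R -> A.
(** [G n] generates a past strictly before [n] that contains both the letters and the noise.
    Independence of [U n] from the past of [U] alone would not allow the past of [X] to be
    frozen. *)
Variable G : int -> set (set T).
Hypothesis f_meas : forall a,
  measurable [set z : past_space a0 * R | f z.1 z.2 = a].
Hypothesis X_meas : forall n a, measurable [set z | X n z = a].
Hypothesis U_meas : forall n, measurable_fun setT (U n).
Hypothesis G_meas : forall n, G n `<=` measurable.
Hypothesis G_X : forall n k a, k < n -> <<s G n >> [set z | X k z = a].
Hypothesis G_U : forall n k S, k < n -> measurable S -> <<s G n >> (U k @^-1` S).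
Hypothesis U_indep : forall n E S, <<s G n >> E -> measurable S ->
  pr P (U n @^-1` S `&` E) = pr (unif R) S * pr P E.
(** The recursion holds only almost surely: the constructed noise takes a junk value when no dart is
    accepted. *)
Hypothesis X_rec : forall n,
  pr P [set z | f (past_of X (n - 1) z) (U n z) <> X n z] = 0.

Local Notation TG n := (g_sigma_algebraType (G n)).

Lemma sG_meas n : <<s G n >> `<=` measurable.
Proof. exact: smallest_sub (@sigma_algebra_measurable _ T) (@G_meas n). Qed.

Lemma U_law n S : measurable S -> pr P (U n @^-1` S) = pr (unif R) S.
Proof.
move=> mS; have := @U_indep n _ _ (@measurableT _ (TG n)) mS.
by rewrite setIT prT mulr1.
Qed.

(** The last variable of a window is independent of a sigma-field containing the events of the
    earlier ones, so the product builds up one factor at a time. *)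
Lemma pr_U_window m N (S : nat -> set R) : (forall j, measurable (S j)) ->
  <<s G (m + N%:Z) >> [set z | forall j, (j < N)%N -> S j (U (m + j%:Z) z)] /\
  pr P [set z | forall j, (j < N)%N -> S j (U (m + j%:Z) z)] =
    \prod_(j < N) pr (unif R) (S j).
Proof.
move=> mS.
have GS M N' : (N' <= M)%N ->
    <<s G (m + M%:Z) >> [set z | forall j, (j < N')%N -> S j (U (m + j%:Z) z)].
  move=> NM; have -> : [set z | forall j, (j < N')%N -> S j (U (m + j%:Z) z)] =
      \bigcap_(j < N') (U (m + j%:Z) @^-1` S j) by [].
  apply: (@fin_bigcap_measurable _ (TG _)) => // j jN.
  by apply: G_U => //; have : (j < N')%N by []; lia.
split; first exact: GS.
elim: N => [|N IH]; first by rewrite big_ord0 -[RHS](prT P); congr pr; apply/seteqP.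
rewrite big_ord_recr /= -IH mulrC -(U_indep (GS N N (leqnn N)) (mS N)).
congr pr; apply/seteqP; split => z /=.
  by move=> Sz; split; [exact: Sz|move=> j jN; apply: Sz; lia].
move=> [SN Sz] j; rewrite ltnS leq_eqVlt => /orP[/eqP->//|]; exact: Sz.
Qed.

Lemma iid_U : iid P U.
Proof.
have PE n S : measurable S -> P (U n @^-1` S) = (pr (unif R) S)%:E.
  by move=> mS; rewrite prE ?U_law//; exact: measurable_preim.
split=> //; split=> [n S mS|s S us mS]; first by rewrite !PE.
(* A finite set of times is enclosed in a window of consecutive ones, the missing times receiving
   the constraint [setT]. *)
have [m [N mN]] : exists m : int, exists N : nat, forall i, i \in s -> m <= i < m + N%:Z.
  clear us; elim: s => [|i s [m [N IH]]]; first by exists 0, 0%N.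
  exists (Num.min m i), (`|m - i|%N + N + 1)%N => k; rewrite inE => /orP[/eqP->|/IH]; lia.
pose S' j := if (m + Posz j) \in s then S (m + Posz j) else setT.
have mS' j : measurable (S' j) by rewrite /S'; case: ifP.
have [GS prS] := pr_U_window m N mS'.
have E : \bigcap_(i in [set` s]) U i @^-1` S i =
    [set z | forall j, (j < N)%N -> S' j (U (m + j%:Z) z)].
  apply/seteqP; split => z /= Sz.
    by move=> j jN; rewrite /S'; case: ifP => // js; exact: Sz.
  move=> i /= si; have := mN i si => /andP[h1 h2].
  have := Sz `|i - m|%N; rewrite /S' (_ : m + _ = i); last by lia.
  by rewrite si; apply; lia.
rewrite E prE; last exact: sG_meas GS.
rewrite prS (eq_bigr (fun i => (pr (unif R) (S i))%:E)); last by move=> i _; exact: PE.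
rewrite prodEFin; congr (_%:E).
transitivity (\prod_(i <- [seq m + Posz j | j <- iota 0 N & m + Posz j \in s])
  pr (unif R) (S i)).
  rewrite big_map big_filter -[N in iota 0 N]subn0 -/(index_iota 0 N) big_mkord.
  rewrite [RHS]big_mkcond; apply: eq_bigr => j _; rewrite /S'.
  by case: ifP => // _; exact: prT.
apply: perm_big; apply: uniq_perm => //.
  by rewrite map_inj_uniq ?filter_uniq ?iota_uniq// => i j; lia.
move=> i; apply/mapP/idP => [[j]|si].
  by rewrite mem_filter => /andP[? _] ->.
have := mN i si => /andP[h1 h2]; exists `|i - m|%N; last lia.
rewrite mem_filter mem_iota (_ : m + _ = i) ?si /=; lia.
Qed.

Let PU : probability (T * R)%type R := (P \x unif R)%E.

Lemma PU_setX B S : measurable B -> measurable S ->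
  pr PU (B `*` S) = pr P B * pr (unif R) S.
Proof.
move=> mB mS; apply: EFin_inj; rewrite -prE; last exact: measurableX.
by rewrite EFinM -!prE// -product_measure1E.
Qed.

(** In an event depending on the past and on [U n], the latter may be replaced by a fresh uniform
    variable. *)
Lemma pr_U_pair n (H : set (T * R)) : measurable (H : set (TG n * R)) ->
  pr P [set z | H (z, U n z)] = pr PU H.
Proof.
move=> mH.
have mid : measurable_fun setT (id : T -> TG n).
  by move=> _ B GB; rewrite setTI; exact: sG_meas GB.
have m1 : measurable_fun setT ((fun z => (z, U n z)) : T -> TG n * R).
  exact: measurable_fun_pair.
have m2 : measurable_fun setT ((fun z => (z.1, z.2)) : T * R -> TG n * R).
  by apply: measurable_fun_pair => //; exact: measurableT_comp mid measurable_fst.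
have -> : [set z | H (z, U n z)] = (fun z => (z, U n z)) @^-1` H `&` setT by rewrite setIT.
have -> : pr PU H = pr PU ((fun z : T * R => (z.1, z.2)) @^-1` H `&` setT).
  by rewrite setIT; congr pr; apply/seteqP; split => -[].
rewrite -[LHS]mul1r -[RHS]mul1r; move: mH.
rewrite measurable_prod_measurableType => mH; move: H mH.
apply: (@pr_unique_sub_sigma R _ _ _ T (T * R)%type (TG n * R)%type P PU) => //.
- by rewrite !prT.
- by move=> _ [B mB [S mS <-]]; exact: measurableX.
- move=> _ _ [B mB [S mS <-]] [B' mB' [S' mS' <-]].
  by exists (B `&` B'); [exact: measurableI|exists (S `&` S'); [exact: measurableI|rewrite setXI]].
- move=> _ [B mB [S mS <-]]; rewrite !mul1r !setIT.
  rewrite (_ : _ @^-1` _ = U n @^-1` S `&` B); last by apply/seteqP; split => z [].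
  rewrite (U_indep mB mS) mulrC -(PU_setX (sG_meas mB) mS).
  by congr pr; apply/seteqP; split => -[].
Qed.

(** A disagreement bound valid for each frozen pair of pasts is integrated over the event [E] of the
    past. *)
Lemma pr_U_le n (E : set T) (g h : T -> nat -> A) (e : R) :
  measurable (E : set (TG n)) ->
  measurable_fun setT (g : TG n -> past_space a0) ->
  measurable_fun setT (h : TG n -> past_space a0) ->
  (forall z, E z -> pr (unif R) [set u | f (g z) u <> f (h z) u] <= e) ->
  pr P (E `&` [set z | f (g z) (U n z) <> f (h z) (U n z)]) <= e * pr P E.
Proof.
move=> mE mg mh ghe.
pose H := [set z : T * R | E z.1 /\ f (g z.1) z.2 <> f (h z.1) z.2].
have mneq : measurable [set z : TG n * R | f (g z.1) z.2 <> f (h z.1) z.2].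
  have mcomp (k : T -> nat -> A) : measurable_fun setT (k : TG n -> past_space a0) ->
      forall a, measurable [set z : TG n * R | f (k z.1) z.2 = a].
    move=> mk a; have m1 : measurable_fun setT
        ((fun z => (k z.1, z.2)) : TG n * R -> past_space a0 * R).
      by apply: measurable_fun_pair => //; exact: measurableT_comp mk measurable_fst.
    exact: measurable_preim m1 (f_meas a).
  by apply: measurable_neq_fin => a; exact: mcomp.
have mH : measurable (H : set (TG n * R)).
  have mE1 : measurable ((fun z : TG n * R => z.1) @^-1` E).
    exact: measurable_preim measurable_fst mE.
  exact: (@measurableI _ (TG n * R)%type _ _ mE1 mneq).
have := pr_U_pair mH; rewrite (_ : [set z | H (z, U n z)] =
  E `&` [set z | f (g z) (U n z) <> f (h z) (U n z)]) // => ->.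
have mET := sG_meas mE.
have mHT : measurable H.
  have m2 : measurable_fun setT ((fun z => (z.1, z.2)) : T * R -> TG n * R).
    apply: measurable_fun_pair => // _ B GB; rewrite setTI.
    exact: measurable_preim measurable_fst (sG_meas GB).
  have := measurable_preim m2 mH.
  by congr measurable; apply/seteqP; split => -[].
rewrite -lee_fin -prE// EFinM -prE// -integral_cst//.
have -> : (\int[P]_(z in E) (cst e%:E) z = \int[P]_z ((cst e%:E) \_ E) z)%E.
  by rewrite integral_mkcond.
apply: ge0_le_integral => //.
- exact: measurable_fun_xsection.
- by apply/(measurable_restrictT _ mET); exact: measurable_cst.
- move=> z _; rewrite patchE /=; case: ifPn; rewrite ?inE ?notin_setE => Ez.
    have secE : xsection H z = [set u | f (g z) u <> f (h z) u].
      by rewrite xsectionE; apply/seteqP; split => u; rewrite /H /=; tauto.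
    have := measurable_xsection z mHT; rewrite secE => ms.
    apply: (@le_trans _ _ (pr (unif R) [set u | f (g z) u <> f (h z) u])%:E).
      by rewrite -prE.
    by rewrite lee_fin; exact: ghe.
  rewrite (_ : xsection H z = set0) ?measure0// xsectionE.
  by apply/seteqP; split => u //= [].
Qed.

(** The recursion starts at time [m] from a constant past. After [j] steps, position 0 carries the
    letter of time [m + j - 1]. *)
Fixpoint run (m : int) (j : nat) z : nat -> A :=
  if j is i.+1 then past_cons (f (run m i z) (U (m + i%:Z) z)) (run m i z)
  else fun=> a0.

(* A lower bound for the length of the common recent past of [run m j] and [X];
   unlike the true length it is finite and at most [j]. *)
Fixpoint agreement (m : int) (j : nat) z : nat :=
  if j is i.+1 then
    if f (run m i z) (U (m + i%:Z) z) == X (m + i%:Z) z then (agreement m i z).+1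
    else 0
  else 0.

Lemma agreement_le m j z : (agreement m j z <= j)%N.
Proof. by elim: j => //= j IH; case: ifP. Qed.

Lemma agreementP m j z k : (k < agreement m j z)%N ->
  run m j z k = past_of X (m + j%:Z - 1) z k.
Proof.
elim: j k => //= j IH k; case: eqP => // e.
have -> : m + j.+1%:Z - 1 = m + j%:Z by lia.
rewrite past_of_cons; case: k => [//|k] /=; rewrite ltnS; exact: IH.
Qed.

(** [F] is left open because three sigma-fields occur: that of [G n], that of all measurable sets,
    and the past of [U] alone. *)
Lemma measurable_run (F : set (set T)) n m j :
  (forall k S, k < n -> measurable S -> <<s F >> (U k @^-1` S)) ->
  m + j%:Z <= n ->
  measurable_fun setT (run m j : g_sigma_algebraType F -> past_space a0).
Proof.
move=> FU; elim: j => [|j IH] mj; first exact: measurable_cst.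
have mr : measurable_fun setT (run m j : g_sigma_algebraType F -> past_space a0).
  by apply: IH; lia.
apply: measurable_pastP => -[|k] a /=.
  have m1 : measurable_fun setT ((fun z => (run m j z, U (m + j%:Z) z)) :
      g_sigma_algebraType F -> past_space a0 * R).
    apply: measurable_fun_pair => // _ S mS; rewrite setTI; apply: FU => //; lia.
  exact: measurable_preim m1 (f_meas a).
exact: measurable_preim mr (measurable_past_coord _ _).
Qed.

Lemma measurable_past_of_G n :
  measurable_fun setT (past_of X (n - 1) : TG n -> past_space a0).
Proof.
by apply: measurable_past_of => k a kn; apply: G_X; lia.
Qed.

Lemma measurable_mismatch (F : set (set T)) n m j :
  (forall k S, k < n -> measurable S -> <<s F >> (U k @^-1` S)) ->
  (forall k a, k < n -> <<s F >> [set z | X k z = a]) ->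
  m + j%:Z < n ->
  <<s F >> [set z | f (run m j z) (U (m + j%:Z) z) <> X (m + j%:Z) z].
Proof.
move=> FU FX mjn.
have mr := measurable_run FU (ltW mjn).
have m1 : measurable_fun setT ((fun z => (run m j z, U (m + j%:Z) z)) :
    g_sigma_algebraType F -> past_space a0 * R).
  by apply: measurable_fun_pair => // _ S mS; rewrite setTI; exact: FU.
apply: (@measurable_neq_fin _ (g_sigma_algebraType F)) => a.
  exact: measurable_preim m1 (f_meas a).
exact: FX.
Qed.

Lemma measurable_agreement (F : set (set T)) n m j l :
  (forall k S, k < n -> measurable S -> <<s F >> (U k @^-1` S)) ->
  (forall k a, k < n -> <<s F >> [set z | X k z = a]) ->
  m + j%:Z <= n -> <<s F >> [set z | agreement m j z = l].
Proof.
move=> FU FX; pose TF := g_sigma_algebraType F.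
elim: j l => [|j IH] l mj.
  case: l => [|l].
    by rewrite (_ : [set z | _] = setT)//; [exact: (@measurableT _ TF)|apply/seteqP; split].
  by rewrite (_ : [set z | _] = set0)//; [exact: (@measurable0 _ TF)|apply/seteqP; split].
have mj' : m + j%:Z < n by lia.
have mm := measurable_mismatch FU FX mj'.
case: l => [|l].
  rewrite (_ : [set z | _] = [set z | f (run m j z) (U (m + j%:Z) z) <> X (m + j%:Z) z]) //.
  by apply/seteqP; split => z /=; case: eqP.
rewrite (_ : [set z | _] = [set z | agreement m j z = l] `&`
    ~` [set z | f (run m j z) (U (m + j%:Z) z) <> X (m + j%:Z) z]).
  apply: (@measurableI _ TF); first by apply: IH; lia.
  exact: (@measurableC _ TF).
apply/seteqP; split => z /=; case: eqP => //.
- by move=> e [<-]; split => //; apply.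
- by move=> e [<-].
- by move=> ne [_]; case.
Qed.

Variable eta : nat -> R.
Hypothesis eta_itv : forall n, 0 <= eta n <= 1.
Hypothesis eta_noninc : forall n, eta n.+1 <= eta n.
Hypothesis eta_agree : forall l x y, (forall k, (k < l)%N -> x k = y k) ->
  pr (unif R) [set u | f x u <> f y u] <= eta l.
Hypothesis eta_diverges :
  (fun K : nat => \sum_(k < K.+1) \prod_(n < k.+1) (1 - eta n)) @ \oo --> +oo.

Let FUm n k S : k < n -> measurable S -> <<s @measurable _ T >> (U k @^-1` S).
Proof. by move=> _ mS; apply: sub_sigma_algebra; exact: measurable_preim. Qed.

Let FXm n k a : k < n -> <<s @measurable _ T >> [set z | X k z = a].
Proof. by move=> _; apply: sub_sigma_algebra; exact: X_meas. Qed.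

Let sm (B : set T) : <<s @measurable _ T >> B -> measurable B.
Proof. by apply: smallest_sub => //; exact: sigma_algebra_measurable. Qed.

Lemma pr_agreement0 m j :
  pr P [set z | agreement m j z = 0%N] <= match_reset eta j.
Proof.
pose law i l := pr P [set z | agreement m i z = l].
pose mis i := [set z | f (run m i z) (U (m + i%:Z) z) <> X (m + i%:Z) z].
pose miss i l := pr P ([set z | agreement m i z = l] `&` mis i).
have mL i l : measurable [set z | agreement m i z = l].
  apply: sm; exact: (measurable_agreement l (@FUm _) (@FXm _) (lexx _)).
have mM i : measurable (mis i).
  by apply: sm; apply: (measurable_mismatch (@FUm (m + i%:Z + 1)) (@FXm _)); lia.
have LS i l : [set z | agreement m i.+1 z = l.+1] =
    [set z | agreement m i z = l] `&` ~` mis i.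
  apply/seteqP; split => z; rewrite /mis /=; case: eqP => //.
  - by move=> e [<-]; split => //; apply.
  - by move=> e [<-].
  - by move=> ne [_]; case.
have L0 i : [set z | agreement m i.+1 z = 0%N] = mis i.
  by apply/seteqP; split => z; rewrite /mis /=; case: eqP.
apply: (@match_reset_bound _ _ eta_itv eta_noninc law miss).
- by rewrite /law -[RHS](prT P); congr pr; apply/seteqP; split.
- by move=> *; exact: pr_ge0.
- move=> i l; pose n := m + i%:Z.
  pose rec := [set z | f (past_of X (n - 1) z) (U n z) <> X n z].
  pose neq := [set z | f (run m i z) (U n z) <> f (past_of X (n - 1) z) (U n z)].
  have mE : <<s G n >> [set z | agreement m i z = l].
    exact: (measurable_agreement l (@G_U _) (@G_X _) (lexx _)).
  have mr := measurable_run (@G_U n) (lexx (m + i%:Z)).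
  have mp := @measurable_past_of_G n.
  have tot (g : T -> nat -> A) : measurable_fun setT (g : TG n -> past_space a0) ->
      forall a, measurable [set z | f (g z) (U n z) = a].
    move=> mg a; have m1 : measurable_fun setT ((fun z => (g z, U n z)) :
        T -> past_space a0 * R).
      apply: measurable_fun_pair => // _ S mS; rewrite setTI; apply: (@sG_meas n).
      by have := mg measurableT _ mS; rewrite setTI.
    exact: measurable_preim m1 (f_meas a).
  have mneq : measurable neq by apply: measurable_neq_fin => a; exact: tot.
  have mrec : measurable rec.
    by apply: measurable_neq_fin => a; [exact: tot|exact: X_meas].
  have le : pr P ([set z | agreement m i z = l] `&` neq) <= eta l * law i l.
    apply: (pr_U_le mE mr mp) => z zl; apply: eta_agree => k kl.
    by apply: agreementP; rewrite zl.
  (* Outside the null event [rec], the letter [X n] is [f] of its own past, so a mismatch means that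
     [f] separates two pasts agreeing on [l] letters. *)
  apply: le_trans le; rewrite -[leRHS]addr0 -(X_rec n).
  have mEn : measurable ([set z | agreement m i z = l] `&` neq) by exact: measurableI.
  apply: le_trans (prU_le P mEn mrec); apply: pr_le.
  + exact: measurableI.
  + exact: measurableU.
  + move=> z [zl ne]; have [e|ne'] := pselect (f (past_of X (n - 1) z) (U n z) = X n z).
      by left; split => //; rewrite /neq /= e.
    by right.
- move=> i l; rewrite /law LS /miss.
  by rewrite (pr_split P (mL i l) (mM i)) [RHS]addrAC subrr add0r.
- move=> i; rewrite /law L0 (@pr_fin_split _ _ _ 'I_i.+1 (fun l => [set z | agreement m i z = l])) //.
  + by apply: eq_bigr => l _; rewrite /miss setIC.
  + by move=> k l z /= e1 e2; apply: val_inj; rewrite /= -e1.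
  + by move=> z; exists (Ordinal (agreement_le m i z : (_ < i.+1)%N)).
Qed.

(* The trajectories started at remote times have [X n] as a limit in probability,
   hence almost surely along a subsequence. *)
Lemma driven_by_noise n a : exists E', natfilt_R U n E' /\
  exists N, [/\ measurable N, P N = 0%E &
    ([set z | X n z = a] `\` E') `|` (E' `\` [set z | X n z = a]) `<=` N].
Proof.
(* Summable bounds, for the Borel-Cantelli lemma. *)
have small k : exists j, match_reset eta j <= 2^-1 ^+ k.+1.
  by apply: match_reset_small => //; apply: exprn_gt0.
have [j jP] := choice small.
(* One step more than [j k], so that the last letter produced is that of time [n];
   [match_reset_noninc] absorbs the extra step. *)
pose Y k z := run (n - (j k)%:Z) (j k).+1 z 0%N.
pose F k := [set z | Y k z <> X n z].
have FE k : F k = [set z | agreement (n - (j k)%:Z) (j k).+1 z = 0%N].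
  apply/seteqP; split => z; rewrite /F /Y /= subrK; case: eqP => //.
have mF k : measurable (F k).
  by rewrite FE; apply: sm; exact: (measurable_agreement 0 (@FUm _) (@FXm _) (lexx _)).
pose gens : set (set T) := [set E | exists (i : int) (S : set R),
    i <= n /\ measurable S /\ E = U i @^-1` S].
have gU k S : k < n + 1 -> measurable S -> <<s gens >> (U k @^-1` S).
  by move=> kn mS; apply: sub_sigma_algebra; exists k, S; split => //; lia.
have mY k : <<s gens >> [set z | Y k z = a].
  have mr : measurable_fun setT (run (n - (j k)%:Z) (j k).+1 :
      g_sigma_algebraType gens -> past_space a0).
    by apply: (measurable_run gU); lia.
  exact: measurable_preim mr (measurable_past_coord 0%N a).
(* An upper limit stays in the sigma-field of the noise. Off the upper limit of the [F k], the
   letters [Y k z] are eventually equal to [X n z]. *)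
exists (lim_sup_set (fun k => [set z | Y k z = a])); split.
  apply: (@bigcapT_measurable _ (g_sigma_algebraType gens)) => i.
  by apply: (@bigcup_measurable _ (g_sigma_algebraType gens)) => k _; exact: mY.
exists (lim_sup_set F); split.
- apply: bigcapT_measurable => i; apply: bigcup_measurable => k _; exact: mF.
- apply: lim_sup_set_cvg0 => //.
  apply: (@le_lt_trans _ _ (\sum_(0 <= i <oo) (1 / (2 ^ i.+1)%:R)%:E)%E).
    apply: lee_nneseries => // k _.
    rewrite [leLHS]prE// lee_fin FE; apply: le_trans (pr_agreement0 _ _) _.
    apply: le_trans (match_reset_noninc eta_itv eta_noninc _) _.
    apply: le_trans (jP k) _.
    by rewrite natrX div1r exprVn.
  by apply: le_lt_trans (epsilon_trick0 _ _) _; rewrite ?ltry.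
- have notlim z : ~ lim_sup_set F z -> exists i, forall k, (i <= k)%N -> Y k z = X n z.
    move=> nl; apply: contrapT => h; apply: nl => i _.
    apply: contrapT => h'; apply: h; exists i => k ik.
    by apply: contrapT => ne; apply: h'; exists k.
  move=> z h; apply: contrapT => /notlim[i iP]; case: h => -[/= h1 h2].
    apply: h2 => l _; exists (maxn i l) => /=; first exact: leq_maxr.
    by rewrite iP ?leq_maxl.
  by have [k /= ik e] := h1 i I; apply: h2; rewrite -e iP.
Qed.

End driven_process.

(** * Construction of the noise *)

Section noise_construction.
Context d (Omega : measurableType d) (R : realType) (P : probability Omega R).
Context (A : finType) (a0 : A) (X : int -> Omega -> A).
Context (p : (nat -> A) -> A -> R).
Hypothesis hXmeas : forall (n : int) (a : A), measurable (X n @^-1` [set a]).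
Hypothesis hstat : stationary P X.
Hypothesis hp : regular_cond_law P X p.

Local Notation S := (past_space a0).

Lemma measurable_past_X n : measurable_fun setT (past_of X n : Omega -> S).
Proof. by apply: measurable_past_of => k a _; exact: hXmeas. Qed.

Lemma measurable_cond_law a : measurable_fun setT ((p ^~ a) : S -> R).
Proof. by move=> _ B mB; rewrite setTI; exact: hp.2.2.1 a B mB. Qed.

Definition cylinder (k : nat) (y : nat -> A) : set (nat -> A) :=
  [set x | forall i, (i < k)%N -> x i = y i].

(** [stationary] reads words forward in time and pasts are read backward, hence the reversed
    tuple. *)
Lemma past_cylinderE n k y : past_of X n @^-1` cylinder k y =
  [set w | forall i : 'I_k, X (n - k%:Z + 1 + (i : nat)%:Z) w =
                            tnth [tuple y (k.-1 - j)%N | j < k] i].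
Proof.
apply/seteqP; split => w /= H i.
  have ik := ltn_ord i; rewrite tnth_mktuple -H; last by lia.
  by rewrite /past_of; congr (X _ w); lia.
move=> ik; have jk : (k.-1 - i < k)%N by lia.
have := H (Ordinal jk); rewrite tnth_mktuple /= (_ : k.-1 - (k.-1 - i) = i)%N; last by lia.
by move=> <-; rewrite /past_of; congr (X _ w); lia.
Qed.

Lemma measurable_cylinder k y : measurable (cylinder k y : set S).
Proof.
have -> : cylinder k y = \bigcap_(i < k) [set x : S | x i = y i] by [].
by apply: fin_bigcap_measurable => // i _; exact: measurable_past_coord.
Qed.

(** Two cylinders are nested or disjoint, so the empty set completes them to a pi-system. *)
Let cyls : set (set S) := [set B | B = set0 \/ exists k y, B = cylinder k y].

Let setI_cyls : setI_closed cyls.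
Proof.
move=> B C; wlog : B C / exists k k' y y', [/\ B = cylinder k y, C = cylinder k' y' & (k <= k')%N].
  move=> wl [->|[k [y eB]]]; first by left; rewrite set0I.
  move=> [->|[k' [y' eC]]]; first by left; rewrite setI0.
  have cB : cyls B by right; exists k, y.
  have cC : cyls C by right; exists k', y'.
  have [kk|kk] := leqP k k'; first by apply: wl => //; exists k, k', y, y'.
  by rewrite setIC; apply: wl => //; exists k', k, y', y; split => //; exact: ltnW.
move=> [k [k' [y [y' [-> -> kk]]]]] _ _.
have [[x [xy xy']]|ne] := pselect (exists x, cylinder k y x /\ cylinder k' y' x).
  right; exists k', y'; apply/seteqP; split => z /=; first by case.
  move=> zy'; split => // i ik; rewrite -xy// zy' ?xy'//; lia.
by left; apply/seteqP; split => // z zyy; apply: ne; exists z.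
Qed.

Lemma past_law_shift1 n (B : set S) : measurable B ->
  pr P (past_of X n @^-1` B) = pr P (past_of X (n + 1) @^-1` B).
Proof.
move=> mB; have {mB} GB : <<s cyls >> B.
  apply: (smallest_sub (@smallest_sigma_algebra _ setT cyls) _ mB) => _ [k [a ->]].
  (* Since [A] is finite, fixing one coordinate is a finite union of cylinders. *)
  have -> : [set x | x k = a] = \bigcup_(z in [set z : (k.+1).-tuple A | tnth z ord_max = a])
      [set x : S | forall i : 'I_k.+1, x i = tnth z i].
    apply/seteqP; split => x /=.
      move=> xk; exists [tuple x i | i < k.+1]; rewrite /= ?tnth_mktuple//.
      by move=> i; rewrite tnth_mktuple.
    by move=> [z /= <- /(_ ord_max)].
  apply: (@fin_bigcup_measurable _ (g_sigma_algebraType cyls)) => // z _.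
  apply: sub_sigma_algebra; right; exists k.+1, (fun i => nth a0 z i).
  apply/seteqP; split => x /=.
    by move=> H i ik; rewrite (H (Ordinal ik)) (tnth_nth a0).
  by move=> H i; rewrite H// (tnth_nth a0).
suff : 1 * pr P (past_of X n @^-1` B `&` setT) =
    1 * pr P (past_of X (n + 1) @^-1` B `&` setT) by rewrite !mul1r !setIT.
move: B GB; apply: (@pr_unique_sub_sigma R _ _ _ Omega Omega S P P) => //.
- exact: measurable_past_X.
- exact: measurable_past_X.
- by move=> C [->|[k [y ->]]]; [exact: measurable0|exact: measurable_cylinder].
move=> C [->|[k [y ->]]]; first by rewrite !preimage_set0.
rewrite !mul1r !setIT !past_cylinderE /pr; congr fine.
rewrite hstat; congr (P _); apply/seteqP; split => w /= H i; rewrite -H;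
  by congr (X _ w); lia.
Qed.

Lemma past_law n m (B : set S) : measurable B ->
  pr P (past_of X n @^-1` B) = pr P (past_of X m @^-1` B).
Proof.
move=> mB.
have up k l : pr P (past_of X k @^-1` B) = pr P (past_of X (k + l%:Z) @^-1` B).
  elim: l => [|l ->]; first by rewrite addr0.
  by rewrite past_law_shift1//; congr (pr P (past_of X _ @^-1` B)); lia.
have [nm|mn] := leP n m.
  by rewrite (up n `|m - n|%N); congr (pr P (past_of X _ @^-1` B)); lia.
by rewrite (up m `|m - n|%N); congr (pr P (past_of X _ @^-1` B)); lia.
Qed.

(** [regular_cond_law] speaks of time 0 only. Both sides depend on the law of the past alone, which
    [past_law] makes independent of time. *)
Lemma cond_law_shift n a (B : set S) : measurable B ->
  P ([set w | X n w = a] `&` past_of X (n - 1) @^-1` B) =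
  (\int[P]_(w in past_of X (n - 1) @^-1` B) (p (past_of X (n - 1) w) a)%:E)%E.
Proof.
move=> mB.
have mp0 := measurable_past_X.
have mC : measurable ([set x : S | x 0%N = a] `&` past_tail @^-1` B).
  apply: measurableI; first exact: measurable_past_coord.
  exact: measurable_preim (@measurable_past_tail A a0) mB.
have E m : [set w | X m w = a] `&` past_of X (m - 1) @^-1` B =
    past_of X m @^-1` ([set x : S | x 0%N = a] `&` past_tail @^-1` B).
  by apply/seteqP; split => w; rewrite /= past_of_tail /past_of subr0.
have mint m : measurable_fun setT (fun x : S => (p x a)%:E).
  by apply/measurable_EFinP; exact: measurable_cond_law.
have p0 x : (0 <= (p x a)%:E)%E by rewrite lee_fin; exact: hp.1.
have I m : (\int[P]_(w in past_of X m @^-1` B) (p (past_of X m w) a)%:E =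
    \int[image_measure P (mp0 m)]_(x in B) (p x a)%:E)%E.
  by rewrite [RHS](ge0_integral_pushforward (mp0 m))//; apply: measurable_funTS; exact: mint.
rewrite I (eq_measure_integral (image_measure P (mp0 (-1)))); last first.
  move=> C mC' _; rewrite !image_measureE [LHS]prE ?[RHS]prE ?(past_law _ (-1))//.
    exact: measurable_preim (mp0 _) mC'.
  exact: measurable_preim (mp0 _) mC'.
rewrite -I -(hp.2.2.2 a B mB) E prE ?(past_law _ 0)//; last first.
  exact: measurable_preim (mp0 _) mC.
by rewrite -prE -?E// E; exact: measurable_preim (mp0 _) mC.
Qed.

Variable f : S -> R -> A.
Hypothesis f_meas : forall a, measurable [set z : S * R | f z.1 z.2 = a].
Hypothesis f_law : forall x a, pr (unif R) [set u | f x u = a] = p x a.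

Let T := (Omega * R)%type.
Let PT : probability T R := (P \x unif R)%E.

(* For uniform [v], the law of [noise x v] is uniform conditioned on [f] sending
   the past [past_tail x] to the letter [x 0]. *)
Definition noise (x : S) (v : R) : R :=
  first_hit [set u | f (past_tail x) u = x 0%N] v.

Lemma measurable_noise : measurable_fun setT (fun z : S * R => noise z.1 z.2).
Proof.
apply: (@measurable_first_hit R _ S [set z : S * R | f (past_tail z.1) z.2 = z.1 0%N]).
have mt : measurable_fun setT (fun z : S * R => ((past_tail z.1 : S), z.2)).
  apply: measurable_fun_pair => //.
  exact: measurableT_comp (@measurable_past_tail A a0) measurable_fst.
rewrite (_ : [set z | _] = \bigcup_(a in [set: A])
    ([set z : S * R | f (past_tail z.1) z.2 = a] `&` [set z : S * R | z.1 0%N = a])).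
  apply: fin_bigcup_measurable => // a _; apply: measurableI.
    exact: measurable_preim mt (f_meas a).
  exact: measurable_preim measurable_fst (measurable_past_coord 0%N a).
by apply/seteqP; split => z /=; [move=> e; exists (z.1 0%N)|move=> [a _ [-> ->]]].
Qed.

Lemma measurable_past_pair n :
  measurable_fun setT (fun z : T => ((past_of X n z.1 : S), z.2)).
Proof.
apply: measurable_fun_pair => //.
exact: measurableT_comp (@measurable_past_X n) measurable_fst.
Qed.

Let mX n a : measurable [set w | X n w = a].
Proof. exact: hXmeas. Qed.

Let mXT n a : measurable [set z : T | X n z.1 = a].
Proof. exact: measurable_preim measurable_fst (mX n a). Qed.

(** The change of order behind the noise: drawing the letter and then a uniform variable conditioned
    on that letter amounts to drawing a uniform variable and reading its letter. *)
Lemma pr_first_hit_mixture n a (B : set (S * R)) : measurable B ->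
  pr PT ([set z | X n z.1 = a] `&` [set z | B (past_of X (n - 1) z.1,
    first_hit [set u | f (past_of X (n - 1) z.1) u = a] z.2)]) =
  pr PT [set z | B (past_of X (n - 1) z.1, z.2) /\
                 f (past_of X (n - 1) z.1) z.2 = a].
Proof.
move=> mB.
pose D := [set z : S * R | B (z.1, first_hit [set u | f z.1 u = a] z.2)].
have mD : measurable D.
  have m1 : measurable_fun setT (fun z : S * R =>
      (z.1, first_hit [set u | f z.1 u = a] z.2)).
    by apply: measurable_fun_pair => //; exact: (measurable_first_hit (f_meas a)).
  exact: measurable_preim m1 mB.
pose C := [set z : S * R | B z /\ f z.1 z.2 = a].
have mC : measurable C by apply: measurableI => //; exact: f_meas.
have mpp := @measurable_past_pair (n - 1).
have mDT : measurable [set z : T | D (past_of X (n - 1) z.1, z.2)].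
  exact: measurable_preim mpp mD.
have mCT : measurable [set z : T | C (past_of X (n - 1) z.1, z.2)].
  exact: measurable_preim mpp mC.
set L := _ `&` _; set Rt := [set z | _ /\ _].
have mL : measurable L by exact: measurableI.
apply: EFin_inj; rewrite -(prE PT mL) -(prE PT mCT).
have fubL := indic_fubini_tonelli P (unif R) mL.
rewrite (indic_fubini_tonelli_FE _ mL) (indic_fubini_tonelli_GE _ mL) in fubL.
apply: etrans fubL _ => /=.
pose F (z : T) : \bar R :=
  (p (past_of X (n - 1) z.1) a * \1_[set z : T | D (past_of X (n - 1) z.1, z.2)] z)%:E.
have mpa : measurable_fun setT (fun z : T => p (past_of X (n - 1) z.1) a).
  apply: measurableT_comp (measurable_cond_law a) _.
  exact: measurableT_comp (@measurable_past_X (n - 1)) measurable_fst.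
have mF : measurable_fun setT F.
  by apply/measurable_EFinP; apply: measurable_funM => //; exact: measurable_indic.
have F0 z : (0 <= F z)%E by rewrite lee_fin mulr_ge0//; exact: hp.1.
have mDv v : measurable [set x : S | D (x, v)].
  by have := @measurable_ysection _ _ S R D v mD; rewrite ysectionE.
(* With [v] fixed, the event [D] is a condition on the past, so [cond_law_shift] replaces the letter
   by its conditional probability. Exchanging the integrals then fixes the past. *)
transitivity (\int[unif R]_v \int[P]_w F (w, v))%E.
  apply: eq_integral => v _ /=.
  have -> : ysection L v = [set w | X n w = a] `&` past_of X (n - 1) @^-1` [set x | D (x, v)].
    by rewrite ysectionE; apply/seteqP; split.
  apply: etrans (cond_law_shift n a (mDv v)) _.
  rewrite integral_mkcond; apply: eq_integral => w _.
  rewrite patchE /F /= indicE; case: ifPn; rewrite ?inE ?notin_setE /= => h.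
    by rewrite mem_set// mulr1.
  by rewrite memNset// mulr0.
rewrite -fubini_tonelli//; apply: eq_integral => w _ /=.
rewrite xsectionE /= (_ : _ @^-1` _ = [set u | C (past_of X (n - 1) w, u)])//.
have mDw : measurable [set v | D (past_of X (n - 1) w, v)].
  by have := @measurable_xsection _ _ S R D (past_of X (n - 1) w) mD; rewrite xsectionE.
have mCw : measurable [set v | C (past_of X (n - 1) w, v)].
  by have := @measurable_xsection _ _ S R C (past_of X (n - 1) w) mC; rewrite xsectionE.
have mBw : measurable [set v | B (past_of X (n - 1) w, v)].
  by have := @measurable_xsection _ _ S R B (past_of X (n - 1) w) mB; rewrite xsectionE.
have mfw : measurable [set u | f (past_of X (n - 1) w) u = a].
  have := @measurable_xsection _ _ S R _ (past_of X (n - 1) w) (f_meas a).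
  by rewrite xsectionE.
transitivity (\int[unif R]_v ((p (past_of X (n - 1) w) a)%:E *
    (\1_[set v | D (past_of X (n - 1) w, v)] v)%:E))%E.
  by apply: eq_integral => v _; rewrite -EFinM /F /= !indicE.
rewrite ge0_integralZl//; last 2 first.
- by apply/measurable_EFinP; exact: measurable_indic.
- by rewrite lee_fin; exact: hp.1.
rewrite integral_indic// setIT.
transitivity ((p (past_of X (n - 1) w) a)%:E *
   (pr (unif R) [set v | D (past_of X (n - 1) w, v)])%:E)%E; first by rewrite -prE.
transitivity ((pr (unif R) [set u | C (past_of X (n - 1) w, u)])%:E); last by rewrite -prE.
(* For a fixed past, [p] is the mass of the accepted set, the very factor in [pr_first_hit]. *)
by rewrite -f_law -EFinM; congr (_%:E); exact: (pr_first_hit mfw mBw).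
Qed.

(** For each fixed point of [Omega] the coordinates are independent, so the other coordinates split
    off; since [ucoord j] is uniform, the whole variable can stand for it. *)
Lemma pr_noise_decouple j (C : set R) (D : set T) : other_coords j C -> measurable D ->
  pr PT [set z : T | C z.2 /\ D (z.1, ucoord j z.2)] = pr (unif R) C * pr PT D.
Proof.
move=> jC mD.
have mC : measurable C.
  apply: (smallest_sub (@sigma_algebra_measurable _ R) _ jC).
  by move=> _ [i [B [_ mB ->]]]; exact: measurable_preim (measurable_ucoord i) mB.
have mm : measurable_fun setT (fun z : T => (z.1, ucoord j z.2)).
  apply: measurable_fun_pair => //.
  exact: measurableT_comp (measurable_ucoord j) measurable_snd.
have mE : measurable [set z : T | C z.2 /\ D (z.1, ucoord j z.2)].
  apply: measurableI; first exact: measurable_preim measurable_snd mC.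
  exact: measurable_preim mm mD.
have mDw w : measurable [set v | D (w, v)].
  by have := measurable_xsection w mD; rewrite xsectionE.
apply: EFin_inj; rewrite EFinM -[LHS]prE// -[pr PT D]/(fine _).
rewrite -/(pr PT D) -(prE PT mD).
transitivity (\int[P]_w ((pr (unif R) C)%:E * unif R (xsection D w)))%E.
  apply: eq_integral => w _ /=.
  transitivity ((pr (unif R) (C `&` ucoord j @^-1` [set v | D (w, v)]))%:E).
    rewrite -prE; first by rewrite xsectionE.
    by apply: measurableI => //; exact: measurable_preim (measurable_ucoord j) (mDw w).
  by rewrite other_coords_indep// EFinM -(prE _ (mDw w)) xsectionE.
rewrite ge0_integralZl//; first exact: measurable_fun_xsection.
by rewrite lee_fin pr_ge0.
Qed.

Definition extX (n : int) (z : T) : A := X n z.1.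

(** [pickle] is injective on the integers, so distinct times use distinct coordinates. *)
Definition innov (n : int) (z : T) : R :=
  noise (past_of X n z.1) (ucoord (pickle n) z.2).

Definition prior (n : int) : set (set T) :=
  [set E | exists (B : set S) (C : set R), [/\ measurable B,
     other_coords (pickle n) C & E = [set z | B (past_of X (n - 1) z.1) /\ C z.2] ] ].

Let other_coords_setT j : other_coords j (setT : set R).
Proof. exact: (@measurableT _ (g_sigma_algebraType _)). Qed.

Let other_coords_meas j (C : set R) : other_coords j C -> measurable C.
Proof.
apply: (smallest_sub (@sigma_algebra_measurable _ R)).
by move=> _ [i [B [_ mB ->]]]; exact: measurable_preim (measurable_ucoord i) mB.
Qed.

Lemma measurable_innov (F : set (set T)) n :
  (forall k a, k <= n -> <<s F >> [set z | extX k z = a]) ->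
  (forall B : set R, measurable B -> <<s F >> [set z : T | B (ucoord (pickle n) z.2)]) ->
  measurable_fun setT (innov n : g_sigma_algebraType F -> R).
Proof.
move=> FX FW.
have mp : measurable_fun setT ((fun z : T => (past_of X n z.1, ucoord (pickle n) z.2)) :
    g_sigma_algebraType F -> S * R).
  apply: measurable_fun_pair; last by move=> _ B mB; rewrite setTI; exact: FW.
  by apply: measurable_pastP => k a; apply: FX; lia.
exact: measurableT_comp measurable_noise mp.
Qed.

Lemma measurable_extX n a : measurable [set z | extX n z = a].
Proof. exact: mXT. Qed.

Lemma measurable_innovT n : measurable_fun setT (innov n).
Proof.
have sm : <<s @measurable _ T >> `<=` @measurable _ T.
  by apply: smallest_sub => //; exact: sigma_algebra_measurable.
have mi : measurable_fun setT (innov n : g_sigma_algebraType (@measurable _ T) -> R).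
  apply: measurable_innov => [k a _|B mB]; apply: sub_sigma_algebra.
    exact: measurable_extX.
  apply: (@measurable_preim _ _ _ _ (fun z : T => ucoord (pickle n) z.2)) mB.
  exact: measurableT_comp (measurable_ucoord _) measurable_snd.
by move=> _ B mB; apply: sm; exact: mi.
Qed.

Lemma prior_meas n : prior n `<=` measurable.
Proof.
move=> _ [B [C [mB /other_coords_meas mC ->]]]; apply: measurableI.
  have mp := measurable_preim (@measurable_past_X (n - 1)) mB.
  exact: measurable_preim measurable_fst mp.
exact: measurable_preim measurable_snd mC.
Qed.

Lemma prior_X (n k : int) a : k < n -> <<s prior n >> [set z | extX k z = a].
Proof.
move=> kn; apply: sub_sigma_algebra.
pose i : int := n - 1 - k.
exists [set x : S | x `|i|%N = a], setT; split => //.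
  exact: measurable_past_coord.
apply/seteqP; split => z; rewrite /extX /past_of /=.
  by rewrite (_ : n - 1 - _ = k)//; rewrite /i; lia.
by move=> [<- _]; congr (X _ _); rewrite /i; lia.
Qed.

Lemma prior_innov (n k : int) B : k < n -> measurable B -> <<s prior n >> (innov k @^-1` B).
Proof.
move=> kn mB; have mi : measurable_fun setT (innov k : g_sigma_algebraType (prior n) -> R).
  apply: measurable_innov => [i a ik|C mC]; first by apply: prior_X; lia.
  apply: sub_sigma_algebra; exists setT, (ucoord (pickle k) @^-1` C); split => //.
    apply: sub_sigma_algebra; exists (pickle k), C; split => // /(pcan_inj (@pickleK int)) e.
    by rewrite e ltxx in kn.
  by apply/seteqP; split => z //= [].
by rewrite -[X in <<s _ >> X]setTI; exact: mi.
Qed.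

(** [pr_first_hit_mixture] is summed over the letter: the noise becomes a plain uniform variable
    independent of the strict past. *)
Lemma pr_innov_past n (B : set S) (C : set R) : measurable B -> measurable C ->
  pr PT [set z | B (past_of X (n - 1) z.1) /\ C (noise (past_of X n z.1) z.2)] =
  pr P (past_of X (n - 1) @^-1` B) * pr (unif R) C.
Proof.
move=> mB mC.
have mnoise : measurable_fun setT (fun z : T => noise (past_of X n z.1) z.2).
  exact: measurableT_comp measurable_noise (measurable_past_pair n).
have mpB := measurable_preim (@measurable_past_X (n - 1)) mB.
have mBT : measurable [set z : T | B (past_of X (n - 1) z.1)].
  exact: measurable_preim measurable_fst mpB.
have mL : measurable [set z : T | B (past_of X (n - 1) z.1) /\ C (noise (past_of X n z.1) z.2)].
  by apply: measurableI => //; exact: measurable_preim mnoise mC.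
have mBC : measurable (B `*` C : set (S * R)) by exact: measurableX.
have mRt : measurable ((past_of X (n - 1) @^-1` B) `*` C : set T) by exact: measurableX.
have -> : pr P (past_of X (n - 1) @^-1` B) * pr (unif R) C =
    pr PT ((past_of X (n - 1) @^-1` B) `*` C).
  by apply: EFin_inj; rewrite EFinM -!prE// -product_measure1E.
have mfp a : measurable [set z : T | f (past_of X (n - 1) z.1) z.2 = a].
  exact: measurable_preim (measurable_past_pair (n - 1)) (f_meas a).
rewrite (@pr_fin_split _ _ _ _ (fun a => [set z : T | X n z.1 = a]) PT _ mL); last 3 first.
- exact: mXT.
- by move=> a b z /= <- <-.
- by move=> z; exists (X n z.1).
rewrite [RHS](@pr_fin_split _ _ _ _
    (fun a => [set z : T | f (past_of X (n - 1) z.1) z.2 = a]) PT _ mRt mfp); last 2 first.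
- by move=> a b z /= <- <-.
- by move=> z; exists (f (past_of X (n - 1) z.1) z.2).
apply: eq_bigr => a _; have := pr_first_hit_mixture n a mBC.
have -> : [set z : T | X n z.1 = a] `&` [set z | (B `*` C) (past_of X (n - 1) z.1,
    first_hit [set u | f (past_of X (n - 1) z.1) u = a] z.2)] =
    [set z | B (past_of X (n - 1) z.1) /\ C (noise (past_of X n z.1) z.2)] `&`
      [set z | X n z.1 = a].
  apply/seteqP; split => z /=; rewrite /noise past_of_tail /past_of subr0.
    by move=> [<- [Bz Cz]].
  by move=> [[Bz Cz] <-].
by [].
Qed.

Lemma pr_innov_rect n (B : set S) (D C : set R) :
  measurable B -> other_coords (pickle n) D -> measurable C ->
  pr PT (innov n @^-1` C `&` [set z | B (past_of X (n - 1) z.1) /\ D z.2]) =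
  pr (unif R) C * (pr P (past_of X (n - 1) @^-1` B) * pr (unif R) D).
Proof.
move=> mB nD mC.
have mnoise : measurable_fun setT (fun z : T => noise (past_of X n z.1) z.2).
  exact: measurableT_comp measurable_noise (measurable_past_pair n).
have mpB := measurable_preim (@measurable_past_X (n - 1)) mB.
have mL : measurable [set z : T | B (past_of X (n - 1) z.1) /\ C (noise (past_of X n z.1) z.2)].
  apply: measurableI; first exact: measurable_preim measurable_fst mpB.
  exact: measurable_preim mnoise mC.
rewrite mulrCA mulrA [in RHS]mulrC -pr_innov_past// -(pr_noise_decouple nD mL).
by congr pr; apply/seteqP; split => z; rewrite /innov /=; tauto.
Qed.

Lemma innov_indep n E C : <<s prior n >> E -> measurable C ->
  pr PT (innov n @^-1` C `&` E) = pr (unif R) C * pr PT E.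
Proof.
move=> nE mC; have miC := measurable_preim (measurable_innovT n) mC.
have rect (B : set S) (D : set R) : measurable B -> other_coords (pickle n) D ->
    pr PT [set z | B (past_of X (n - 1) z.1) /\ D z.2] =
    pr P (past_of X (n - 1) @^-1` B) * pr (unif R) D.
  move=> mB /other_coords_meas mD.
  have mpB := measurable_preim (@measurable_past_X (n - 1)) mB.
  apply: EFin_inj; rewrite EFinM -!prE// -?product_measure1E//.
  exact: (measurableX mpB mD).
suff : 1 * pr PT (id @^-1` E `&` innov n @^-1` C) =
    pr (unif R) C * pr PT (id @^-1` E `&` setT).
  by rewrite mul1r setIT preimage_id setIC.
move: E nE; apply: (@pr_unique_sub_sigma R _ _ _ T T T PT PT id id (@measurable_id _ T setT)
  (@measurable_id _ T setT) _ _ _ _ miC measurableT ler01 (pr_ge0 _ _)).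
- have := pr_innov_rect measurableT (@other_coords_setT (pickle n)) mC.
  rewrite preimage_setT !prT !mulr1 mul1r => <-; congr pr.
  by apply/seteqP; split => z //= [].
- exact: prior_meas.
- move=> _ _ [B [D [mB nD ->]]] [B' [D' [mB' nD' ->]]].
  exists (B `&` B'), (D `&` D'); split; first exact: measurableI.
    exact: (@measurableI _ (g_sigma_algebraType _) _ _ nD nD').
  by apply/seteqP; split => z /=; tauto.
move=> _ [B [D [mB nD ->]]]; rewrite mul1r setIT !preimage_id (rect B D mB nD).
by rewrite -(pr_innov_rect mB nD mC) setIC.
Qed.

(** After the change of order, the failure event asks that [f] both give the letter [a] and not give
    it. This also disposes of the case where no dart is accepted. *)
Lemma innov_rec n :
  pr PT [set z | f (past_of extX (n - 1) z) (innov n z) <> extX n z] = 0.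
Proof.
pose D := [set z : T | f (past_of X (n - 1) z.1) (noise (past_of X n z.1) z.2) <> X n z.1].
have mpp := @measurable_past_pair (n - 1).
have mnoise : measurable_fun setT (fun z : T => noise (past_of X n z.1) z.2).
  exact: measurableT_comp measurable_noise (measurable_past_pair n).
have mf2 : measurable_fun setT (fun z : T =>
    ((past_of X (n - 1) z.1 : S), noise (past_of X n z.1) z.2)).
  apply: measurable_fun_pair => //.
  exact: measurableT_comp (@measurable_past_X (n - 1)) measurable_fst.
have mD : measurable D.
  by apply: measurable_neq_fin => a; [exact: measurable_preim mf2 (f_meas a)|exact: mXT].
have := pr_noise_decouple (@other_coords_setT (pickle n)) mD.
rewrite prT mul1r => E.
transitivity (pr PT D).
  by rewrite -E; congr pr; apply/seteqP; split => z; [move=> Dz; split|case].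
rewrite (@pr_fin_split _ _ _ _ (fun a => [set z : T | X n z.1 = a]) PT _ mD); last 3 first.
- exact: mXT.
- by move=> a b z /= <- <-.
- by move=> z; exists (X n z.1).
apply: big1 => a _.
have mB : measurable [set z : S * R | f z.1 z.2 <> a].
  rewrite (_ : [set z | _] = ~` [set z : S * R | f z.1 z.2 = a])//.
  exact: measurableC.
rewrite -[RHS](pr0 PT).
transitivity (pr PT [set z : T | [set z : S * R | f z.1 z.2 <> a]
    (past_of X (n - 1) z.1, z.2) /\ f (past_of X (n - 1) z.1) z.2 = a]); last first.
  by congr pr; apply/seteqP; split => z; case.
rewrite -(pr_first_hit_mixture n a mB); congr pr.
apply/seteqP; split => z; rewrite /D /= /noise past_of_tail /past_of subr0.
  by move=> [ne <-].
by move=> [<-].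
Qed.

End noise_construction.

(** * Standardness *)

Section delta.
Context (R : realType) (A : finType) (a0 : A) (p : (nat -> A) -> A -> R).
Hypothesis p_ge0 : forall x a, 0 <= p x a.
Hypothesis p_sum1 : forall x, \sum_(a : A) p x a = 1.

Let tvs n := [set r : R | exists (x y : nat -> A) (z : n.-tuple A),
  r = tv (p (past_cat x z)) (p (past_cat y z))].

Lemma tv_itv x y : 0 <= tv (p x) (p y) <= 1.
Proof.
apply/andP; split; first by apply: mulr_ge0 => //; exact: sumr_ge0.
rewrite /tv ler_pdivrMl// mulr1.
apply: (@le_trans _ _ (\sum_a (p x a + p y a))); last by rewrite big_split /= !p_sum1.
apply: ler_sum => a _; apply: le_trans (ler_normB _ _) _.
by rewrite !ger0_norm.
Qed.

Let tvs_ub n : has_ubound (tvs n).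
Proof. by exists 1 => _ [x [y [z ->]]]; case/andP: (tv_itv (past_cat x z) (past_cat y z)). Qed.

Let tvs_sup n : has_sup (tvs n).
Proof.
split; last exact: tvs_ub.
by exists (tv (p (past_cat (fun=> a0) (nseq_tuple n a0))) (p (past_cat (fun=> a0) (nseq_tuple n a0)))),
  (fun=> a0), (fun=> a0), (nseq_tuple n a0).
Qed.

(** [past_cat] takes its word in chronological order, hence the reversal. Two pasts agreeing on [n]
    letters thus compete in the supremum defining [delta]. *)
Lemma past_cat_take n (x w : nat -> A) : (forall k, (k < n)%N -> w k = x k) ->
  past_cat (fun k => w (k + n)%N) [tuple x (n.-1 - i)%N | i < n] = w.
Proof.
move=> wx; apply/funext => k; rewrite /past_cat; case: ifPn => [kn|]; last first.
  by rewrite -leqNgt => nk; rewrite subnK.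
have jn : (n.-1 - k < n)%N by lia.
rewrite -[(n.-1 - k)%N]/(nat_of_ord (Ordinal jn)) -tnth_nth tnth_mktuple /= wx//.
by congr x; lia.
Qed.

Lemma tv_le_delta n x y : (forall k, (k < n)%N -> x k = y k) ->
  tv (p x) (p y) <= delta p n.
Proof.
move=> xy; apply: ub_le_sup; first exact: tvs_ub.
exists (fun k => x (k + n)%N), (fun k => y (k + n)%N), [tuple y (n.-1 - i)%N | i < n].
by rewrite !past_cat_take.
Qed.

Lemma delta_noninc n : delta p n.+1 <= delta p n.
Proof.
apply: ge_sup; first by case: (tvs_sup n.+1).
move=> _ [x [y [z ->]]]; apply: tv_le_delta => k kn.
by rewrite /past_cat ltnS ltnW//; apply: set_nth_default; rewrite size_tuple; lia.
Qed.

Lemma delta_itv n : 0 <= delta p n <= 1.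
Proof.
apply/andP; split.
  apply: le_trans (_ : tv (p (fun=> a0)) (p (fun=> a0)) <= _); last exact: tv_le_delta.
  by case/andP: (tv_itv (fun=> a0) (fun=> a0)).
apply: ge_sup; first by case: (tvs_sup n).
by move=> _ [x [y [z ->]]]; case/andP: (tv_itv (past_cat x z) (past_cat y z)).
Qed.

End delta.

(** * Immersion in the filtration of the innovations *)

Section standardness.
Context d (Omega : measurableType d) (R : realType) (P : probability Omega R).
Context (A : finType) (a0 : A) (X : int -> Omega -> A).
Context (p : (nat -> A) -> A -> R).
Hypothesis hXmeas : forall (n : int) (a : A), measurable (X n @^-1` [set a]).
Hypothesis hstat : stationary P X.
Hypothesis hp : regular_cond_law P X p.

Local Notation S := (past_space a0).

Let T := (Omega * R)%type.
Let PT : probability T R := (P \x unif R)%E.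

(** The preimages under [fst] form a sigma-field containing the generators. Events of the letters
    thus ignore the added noise. *)
Lemma natfilt_fin_fst (n : int) (E : set T) : natfilt_fin (fun n => X n \o fst) n E ->
  exists b, measurable b /\ E = fst @^-1` b.
Proof.
move: E; apply: (@smallest_sub _ _ _
  [set E : set T | exists b, measurable b /\ E = fst @^-1` b]).
  split.
  - by exists set0.
  - by move=> _ [b [mb ->]]; exists (~` b); rewrite setTD; split => //; exact: measurableC.
  - move=> F /choice[b bP]; exists (\bigcup_k b k); split.
      by apply: bigcupT_measurable => k; case: (bP k).
    by rewrite preimage_bigcup; apply: eq_bigcupr => k _; case: (bP k).
move=> _ [k [B [_ ->]]]; exists (X k @^-1` B); split => //.
rewrite (_ : X k @^-1` B = \bigcup_(a in B) (X k @^-1` [set a])).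
  by apply: fin_bigcup_measurable => //; exact: finite_finset.
by apply/seteqP; split => w /= => [Bw|[a Ba ->//]]; exists (X k w).
Qed.

Variables (c : R) (f : S -> R -> A).
Hypothesis f_coupling : coupling_map (p : S -> A -> R) c f.
Variable eta : nat -> R.
Hypothesis eta_itv : forall n, 0 <= eta n <= 1.
Hypothesis eta_noninc : forall n, eta n.+1 <= eta n.
Hypothesis eta_agree : forall l x y, (forall k, (k < l)%N -> x k = y k) ->
  c * tv (p x) (p y) <= eta l.
Hypothesis eta_diverges :
  (fun K : nat => \sum_(k < K.+1) \prod_(n < k.+1) (1 - eta n)) @ \oo --> +oo.

Let f_meas : forall a, measurable [set z : S * R | f z.1 z.2 = a].
Proof. by case: f_coupling. Qed.

Let f_law : forall x a, pr (unif R) [set u | f x u = a] = p x a.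
Proof. by case: f_coupling. Qed.

Let U := innov X f.

Lemma innov_driven n a : exists E', natfilt_R U n E' /\
  exists N, [/\ measurable N, PT N = 0%E &
    ([set z | extX X n z = a] `\` E') `|` (E' `\` [set z | extX X n z = a]) `<=` N].
Proof.
apply: (@driven_by_noise A a0 _ _ R PT (extX X) U f (prior a0 X) f_meas
  _ _ _ _ _ _ _ eta) => //.
- exact: measurable_extX.
- exact: measurable_innovT.
- exact: prior_meas.
- exact: prior_X.
- exact: prior_innov.
- exact: (innov_indep hXmeas hstat hp f_meas f_law).
- exact: (innov_rec hXmeas hstat hp f_meas f_law).
- by move=> l x y xy; case: f_coupling => _ _ fxy; apply: le_trans (fxy x y) _; exact: eta_agree.
Qed.

(** The sets equal, up to a null set, to an event of the past of [U] form a sigma-field, so single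
    letters suffice. *)
Lemma natfilt_fin_driven (n : int) (E : set T) : natfilt_fin (fun n => X n \o fst) n E ->
  exists E', natfilt_R U n E' /\
    exists N, [/\ measurable N, PT N = 0%E & (E `\` E') `|` (E' `\` E) `<=` N].
Proof.
pose D := [set E : set T | exists E', natfilt_R U n E' /\
    exists N, [/\ measurable N, PT N = 0%E & (E `\` E') `|` (E' `\` E) `<=` N]].
pose gens : set (set T) := [set E | exists (k : int) (B : set R),
  k <= n /\ measurable B /\ E = U k @^-1` B].
have sD : sigma_algebra setT D.
  split.
  - exists set0; split; first exact: (@measurable0 _ (g_sigma_algebraType gens)).
    by exists set0; split => //; rewrite !setD0 setU0.
  - move=> F [F' [nF' [N [mN N0 FN]]]]; exists (~` F'); split.
      exact: (@measurableC _ (g_sigma_algebraType gens)).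
    exists N; split => // z h; apply: FN; rewrite setTD in h.
    by case: h => -[/= h1 h2]; [right|left]; split => //; apply: contrapT.
  - move=> F /choice[F' F'P].
    have [N NP] := choice (fun k => (F'P k).2).
    exists (\bigcup_k F' k); split.
      apply: (@bigcupT_measurable _ (g_sigma_algebraType gens)) => k.
      exact: (F'P k).1.
    exists (\bigcup_k N k); split.
    + by apply: bigcupT_measurable => k; case: (NP k).
    + apply/negligibleP; first by apply: bigcupT_measurable => k; case: (NP k).
      apply: negligible_bigcup => k; have [mN N0 _] := NP k.
      by apply/negligibleP.
    + move=> z [[[k _ Fz] nz]|[[k _ Fz] nz]]; exists k => //; have [_ _] := NP k; apply.
        by left; split => // F'z; apply: nz; exists k.
      by right; split => // F'z; apply: nz; exists k.
move: E; apply: (smallest_sub (X := D) sD) => _ [k [B [kn ->]]].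
rewrite (_ : _ @^-1` B = \bigcup_(a in B) [set z | extX X k z = a]); last first.
  apply/seteqP; split => w /=; first by move=> Bw; exists (extX X k w).
  by move=> [a Ba e]; rewrite -[X k w.1]/(extX X k w) e.
rewrite -(sigma_algebra_id sD).
apply: (@fin_bigcup_measurable _ (g_sigma_algebraType D)); first exact: finite_finset.
move=> a _; apply: sub_sigma_algebra.
have [E' [nE' EN]] := innov_driven k a; exists E'; split => //.
apply: (smallest_sub (@smallest_sigma_algebra _ setT gens) _ nE').
move=> _ [i [C [ik [mC ->]]]]; apply: sub_sigma_algebra.
by exists i, C; split => //; exact: le_trans ik kn.
Qed.

Lemma innov_cond_indep (n : int) :
  cond_indep PT (natfilt_fin (fun n => X n \o fst) (n + 1)) (natfilt_R U n)
    (natfilt_fin (fun n => X n \o fst) n).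
Proof.
move=> E1 E2 /natfilt_fin_fst[e1 [me1 ->]] nE2 g1 g2 g12.
pose gensX : set (set T) := [set E | exists (k : int) (B : set A),
  k <= n /\ E = (X k \o fst) @^-1` B].
have mU k : measurable_fun setT (U k) by exact: measurable_innovT.
have mE2 : measurable E2.
  apply: (smallest_sub (@sigma_algebra_measurable _ T) _ nE2).
  by move=> _ [k [C [_ [mC ->]]]]; exact: measurable_preim (mU k) mC.
(* The parameter is a second copy of the noise: [E2] with its noise frozen is an event of the
   letters up to [n], and [E1] ignores the noise. *)
apply: (@cond_indep_sections _ T R PT gensX _ _ R (unif R)
  [set z : T * R | E2 (z.1.1, z.2)]) => //.
- by move=> E /natfilt_fin_fst[b [mb ->]]; exact: measurable_preim measurable_fst mb.
- pose TX := g_sigma_algebraType gensX.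
  move: E2 nE2 {mE2}; apply: (@smallest_sub _ _ _
    [set E : set T | measurable ([set z | E (z.1.1, z.2)] : set (TX * R))]).
    split.
    + exact: measurable0.
    + by move=> F mF; rewrite /= (_ : [set z | _] = ~` [set z | F (z.1.1, z.2)]);
        [exact: measurableC|apply/seteqP; split => z /=; tauto].
    + move=> F mF /=; rewrite (_ : [set z | _] = \bigcup_k [set z | F k (z.1.1, z.2)]).
        exact: bigcupT_measurable.
      by apply/seteqP; split => z.
  move=> _ [k [C [kn [mC ->]]]] /=.
  have mp : measurable_fun setT ((fun z => (past_of X k z.1.1, ucoord (pickle k) z.2)) :
      TX * R -> S * R).
    apply: measurable_fun_pair; last first.
      exact: measurableT_comp (measurable_ucoord _) measurable_snd.
    have mpX : measurable_fun setT ((fun z => past_of X k z.1) : TX -> S).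
      apply: measurable_pastP => i a; apply: sub_sigma_algebra.
      exists (k - i%:Z), [set a]; split => //; lia.
    exact: measurableT_comp mpX measurable_fst.
  exact: measurable_preim mp (measurable_preim (measurable_noise f_meas) mC).
- exact: measurable_preim measurable_fst me1.
- have sec (c' : set Omega) : measurable c' ->
      PT (fst @^-1` c' `&` E2) =
      (\int[unif R]_v PT (fst @^-1` c' `&` [set w | E2 (w.1, v)]))%E.
    move=> mc.
    have mL : measurable (fst @^-1` c' `&` E2 : set T).
      by apply: measurableI => //; exact: measurable_preim measurable_fst mc.
    have fub := indic_fubini_tonelli P (unif R) mL.
    rewrite indic_fubini_tonelli_FE// indic_fubini_tonelli_GE// in fub.
    apply: etrans fub _; apply: eq_integral => v _ /=.
    have my := measurable_ysection v mL.
    transitivity (PT (ysection (fst @^-1` c' `&` E2) v `*` setT)).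
      apply/esym; apply: etrans (product_measure1E _ _ my measurableT) _.
      by rewrite [X in (_ * X)%E](@probability_setT _ _ _ (unif R)) mule1.
    congr (PT _); rewrite ysectionE.
    by apply/seteqP; split => -[w u] /= => [[]|].
  move=> B /natfilt_fin_fst[b [mb ->]]; split; first exact: sec.
  by rewrite -preimage_setI; apply: sec; exact: measurableI.
Qed.

Lemma standard_of_coupling : standard P X.
Proof.
exists _, T, PT, fst, U; split.
- exact: measurable_fst.
- move=> E mE; apply: etrans (_ : PT (E `*` setT) = _).
    by congr (PT _); apply/seteqP; split => -[w u] //= [].
  apply: etrans (product_measure1E _ _ mE measurableT) _.
  by rewrite [X in (_ * X)%E](@probability_setT _ _ _ (unif R)) mule1.
- apply: (@iid_U _ _ R PT U (prior a0 X)).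
  + exact: measurable_innovT.
  + exact: prior_meas.
  + exact: prior_innov.
  + exact: (innov_indep hXmeas hstat hp f_meas f_law).
- split; first exact: natfilt_fin_driven.
  exact: innov_cond_indep.
Qed.

End standardness.

Unset Implicit Arguments.
Set Strict Implicit.

Theorem theorem2 (d : measure_display) (Omega : measurableType d) (R : realType)
  (P : probability Omega R) (A : finType) (X : int -> Omega -> A)
  (p : (nat -> A) -> A -> R)
  (hXmeas : forall (n : int) (a : A), measurable (X n @^-1` [set a]))
  (hstat : stationary P X)
  (hp : regular_cond_law P X p) :
  (2 * delta p 0 < 1 ->
   (fun K : nat => \sum_(k < K.+1) \prod_(n < k.+1) (1 - 2 * delta p n)) @ \oo --> +oo ->
   standard P X) /\
  (#|A| = 2%N ->
   (fun K : nat => \sum_(k < K.+1) \prod_(n < k.+1) (1 - delta p n)) @ \oo --> +oo ->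
   standard P X).
Proof.
(* Measurable types are pointed, so a value of [X] supplies a letter. *)
pose a0 := X 0 point.
have [p0 [p1 _]] := hp.
have mp := @measurable_cond_law _ _ _ _ _ a0 _ _ hp.
have dn := @delta_noninc _ _ a0 _ p0 p1.
have d01 := @delta_itv _ _ a0 _ p0 p1.
have dle := @tv_le_delta _ _ _ p0 p1.
split=> [d0|A2] div.
  have [f fP] := @exists_coupling_map _ _ (past_space a0) _ _ p0 p1 mp a0.
  (* With [2 * delta p 0 < 1], this keeps every [2 * delta p n] in [0, 1], as a reset probability
     must be. *)
  have d0n n : delta p n <= delta p 0.
    by elim: n => // n IH; exact: le_trans (dn n) IH.
  apply: (standard_of_coupling hXmeas hstat hp fP (eta := fun n => 2 * delta p n)) => //.
  - by move=> n; have := d0n n; have := d01 n; lra.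
  - by move=> n; have := dn n; lra.
  - by move=> l x y xy; have := dle l x y xy; lra.
have [f fP] := @exists_coupling_map2 _ _ (past_space a0) _ _ p0 p1 mp A2.
apply: (standard_of_coupling hXmeas hstat hp fP (eta := delta p)) => //.
by move=> l x y xy; rewrite mul1r; exact: dle.
Qed.
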